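(* Let $H_i,H:[0,T]\times\mathbb{R}^n\times\mathbb{R}^n\to\mathbb{R}$, $i\in\mathbb{N}$, be admissible (see context). Let $(\mathbb{R}^{n+1},f_i,l_i)$ and $(\mathbb{R}^{n+1},f,l)$ be the canonical noncompact representations of $H_i$ and $H$, respectively (see context). If $$\sup_{(x,p)\in B_R\times\mathbb{R}^n}\frac{|H_i(t,x,p)-H(t,x,p)|}{1+|p|}\xrightarrow[i\to\infty]{}0\qquad\text{for all } t\in[0,T],\ R>0,$$ then for all $t\in[0,T]$ and $R>0$ $$\sup_{(x,a)\in B_R\times\mathbb{R}^{n+1}}|f_i(t,x,a)-f(t,x,a)|\xrightarrow[i\to\infty]{}0,\qquad \sup_{(x,a)\in B_R\times\mathbb{R}^{n+1}}|l_i(t,x,a)-l(t,x,a)|\xrightarrow[i\to\infty]{}0.$$ Furthermore, if there are measurable $c_i,c:[0,T]\to[0,\infty)$ with $|H_i(t,x,p)-H_i(t,x,q)|\le c_i(t)(1+|x|)|p-q|$ and $|H(t,x,p)-H(t,x,q)|\le c(t)(1+|x|)|p-q|$ for all $t\in[0,T]$, $x,p,q\in\mathbb{R}^n$, $i\in\mathbb{N}$, then $|f_i(t,x,a)|\le c_i(t)(1+|x|)$ and $|f(t,x,a)|\le c(t)(1+|x|)$ for all $t\in[0,T]$, $x\in\mathbb{R}^n$, $a\in\mathbb{R}^{n+1}$, $i\in\mathbb{N}$.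
   Context: $|\cdot|$ is the Euclidean norm, $B(y,r)$ is the closed ball with center $y$ and radius $r\ge0$, $B_R$ is the closed ball in $\mathbb{R}^n$ centered at $0$ with radius $R$, $d(y,K):=\inf_{z\in K}|y-z|$. A null set is a set of Lebesgue measure zero. A modulus is a function $w:[0,T]\times[0,\infty)\to[0,\infty)$ such that $w(\cdot,r)$ is measurable for every $r\ge0$ and, for every $t$, $w(t,\cdot)$ is nondecreasing, continuous, subadditive and $w(t,0)=0$. A function $H:[0,T]\times\mathbb{R}^n\times\mathbb{R}^n\to\mathbb{R}$ is called admissible if $H(\cdot,x,p)$ is measurable for all $(x,p)$, $H(t,\cdot,\cdot)$ is continuous for every $t$, $H(t,x,\cdot)$ is convex for every $(t,x)$, and for every $R>0$ there are a measurable $k_R:[0,T]\to[0,\infty)$, a modulus $w_R$ and a null set $\mathcal{N}_R$ such that $|H(t,x,p)-H(t,y,p)|\le k_R(t)|p||x-y|+w_R(t,|x-y|)$ for all $t\in[0,T]\setminus\mathcal{N}_R$, $x,y\in B_R$, $p\in\mathbb{R}^n$. (These data may be different for each $H_i$.) Steiner point: for a nonempty convex compact $K\subset\mathbb{R}^m$ let $\sigma(K,p):=\max_{x\in K}\langle p,x\rangle$, and let $m(\partial\sigma(K,p))$ be the element of minimal norm of the subdifferential of the convex function $\sigma(K,\cdot)$ at $p$. Then $s_m(K):=\frac{1}{\mathrm{vol}(B)}\int_{B}m(\partial\sigma(K,p))\,dp\in K$, where $B$ is the closed unit ball of $\mathbb{R}^m$. Canonical noncompact representation: for admissible $H$ put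 $L(t,x,v):=\sup_{p\in\mathbb{R}^n}\{\langle v,p\rangle-H(t,x,p)\}$ and $E_L(t,x):=\{(v,\eta)\in\mathbb{R}^n\times\mathbb{R}: L(t,x,v)\le\eta\}$, which is a nonempty closed convex subset of $\mathbb{R}^{n+1}$. For $a\in\mathbb{R}^{n+1}$ define $e(t,x,a):=s_{n+1}\big(E_L(t,x)\cap B(a,2d(a,E_L(t,x)))\big)\in\mathbb{R}^{n+1}$, and define $f(t,x,a)\in\mathbb{R}^n$, $l(t,x,a)\in\mathbb{R}$ by $e(t,x,a)=(f(t,x,a),l(t,x,a))$. The triple $(\mathbb{R}^{n+1},f,l)$ is the canonical noncompact representation of $H$. *)

(* Defs.v *)
From HB Require Import structures.
From mathcomp Require Import all_boot all_order all_algebra.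
From mathcomp Require Import all_classical all_reals all_analysis.
From mathcomp Require Import measurable_realfun.

Set Implicit Arguments.
Unset Strict Implicit.
Unset Printing Implicit Defensive.
Import Order.TTheory GRing.Theory Num.Theory.
Import numFieldNormedType.Exports.
Local Open Scope classical_set_scope.
Local Open Scope ring_scope.

(* The library norm on 'rV[R]_m is the sup norm, hence [enorm].  The topology
   of 'rV[R]_m is the same for both norms and is taken from the library. *)
Section euclidean.
Context {R : realType} {m : nat}.
Implicit Types (x y p : 'rV[R]_m) (K : set 'rV[R]_m).

Definition dot x y : R := \sum_i x 0 i * y 0 i.

Definition enorm x : R := Num.sqrt (dot x x).

Definition eball x (r : R) : set 'rV[R]_m := [set y | enorm (y - x) <= r].

Definition edist y K : R := inf [set enorm (y - z) | z in K].

Definition support_fun K p : R := sup [set dot p x | x in K].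

Definition subdifferential (g : 'rV[R]_m -> R) p : set 'rV[R]_m :=
  [set v | forall q, g p + dot v (q - p) <= g q].

Definition min_norm_elt K : 'rV[R]_m :=
  xget 0 [set v | K v /\ forall u, K u -> enorm v <= enorm u].

End euclidean.

(* Lebesgue measure on the Borel sets of R^m, by slicing along the first
   coordinate.  It lives on tuples, which carry the product sigma-algebra. *)
Fixpoint lebesgue_tuple {R : realType} (m : nat) : set (m.-tuple R) -> \bar R :=
  match m with
  | 0 => \d_([tuple] : 0.-tuple R)
  | k.+1 => fun A => (\int[lebesgue_measure]_x
      lebesgue_tuple [set y : k.-tuple R | A [tuple of x :: y]])%E
  end.

Section lebesgue_tuple_measure.
Context {R : realType}.
Local Open Scope ereal_scope.

Let cons_pair k (z : measurableTypeR R * k.-tuple R) : k.+1.-tuple R :=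
  [tuple of z.1 :: z.2].

Let split_tuple k (t : k.+1.-tuple R) : measurableTypeR R * k.-tuple R :=
  (thead t, [tuple of behead t]).

Let measurable_cons_pair k : measurable_fun setT (@cons_pair k).
Proof. by apply: measurable_cons; [exact: measurable_fst|exact: measurable_snd]. Qed.

Let measurable_split_tuple k : measurable_fun setT (@split_tuple k).
Proof.
apply: measurable_fun_pair; last exact: measurable_behead.
exact: (@measurable_tnth _ (measurableTypeR R) k.+1 ord0).
Qed.

Let cons_pairK k : cancel (@cons_pair k) (@split_tuple k).
Proof. by move=> [x y]; congr pair; exact/val_inj. Qed.

Lemma lebesgue_tuple_sigma_finite_measure m :
  exists mu : {sigma_finite_measure set (m.-tuple R) -> \bar R},
    @lebesgue_tuple R m = mu.
Proof.
elim: m => [|k [mu muE]].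
  by exists (\d_([tuple] : 0.-tuple R)).
pose P : {measure set _ -> \bar R} := @lebesgue_measure R \x mu.
have E A : @lebesgue_tuple R k.+1 A = P (@cons_pair k @^-1` A).
  rewrite /= muE /P /product_measure1; apply: eq_integral => x _ /=.
  congr (mu _); apply/seteqP; split => y /=; rewrite /xsection /= inE; exact.
have E0 : @lebesgue_tuple R k.+1 set0 = 0 by rewrite E preimage_set0 measure0.
have E1 A : 0 <= @lebesgue_tuple R k.+1 A by rewrite E measure_ge0.
have mpre A : measurable A -> measurable (@cons_pair k @^-1` A).
  by move=> mA; rewrite -[X in measurable X]setTI; exact: measurable_cons_pair.
have E2 : semi_sigma_additive (@lebesgue_tuple R k.+1).
  move=> F mF tF mUF; rewrite E preimage_bigcup.
  rewrite (_ : (fun n => _) =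
      fun n => \sum_(0 <= i < n) P (@cons_pair k @^-1` F i)); last first.
    by apply/funext => n; apply: eq_bigr => i _; rewrite E.
  apply: measure_semi_sigma_additive.
  - by move=> i; exact: mpre.
  - apply/trivIsetP => i j _ _ ij; rewrite -preimage_setI.
    by move/trivIsetP : tF => -> //; rewrite preimage_set0.
  - by rewrite -preimage_bigcup; exact: mpre.
have E3 : sigma_finite setT (@lebesgue_tuple R k.+1).
  have /sigma_finiteP[F [UF ndF Foo]] := sigma_finiteT (@lebesgue_measure R).
  have /sigma_finiteP[G [UG ndG Goo]] := sigma_finiteT mu.
  exists (fun i => @split_tuple k @^-1` (F i `*` G i)).
    rewrite -preimage_bigcup (_ : \bigcup_i _ = setT) ?preimage_setT//.
    rewrite -setXTT UF UG predeqE => -[x y]; split.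
      by move=> [n _ []/= ? ?]; split; exists n.
    move=> [/= [n _ Fnx] [i _ Giy]]; exists (maxn n i) => //; split.
    - by move: x Fnx; exact/subsetPset/ndF/leq_maxl.
    - by move: y Giy; exact/subsetPset/ndG/leq_maxr.
  move=> i; have [mFi Fi] := Foo i; have [mGi Gi] := Goo i; split.
    rewrite -[X in measurable X]setTI; apply: measurable_split_tuple => //.
    exact: measurableX.
  rewrite E -comp_preimage (_ : _ \o _ = id); last first.
    by apply/funext => z /=; rewrite cons_pairK.
  rewrite preimage_id.
  have -> : P (F i `*` G i) = lebesgue_measure (F i) * mu (G i).
    exact: product_measure1E.
  by rewrite lte_mul_pinfty// ge0_fin_numE.
pose M := isMeasure.Build _ _ _ _ E0 E1 E2.
pose M' : {measure set (k.+1.-tuple R) -> \bar R} := HB.pack (@lebesgue_tuple R k.+1) M.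
pose S := Measure_isSigmaFinite.Build _ _ _ M' E3.
pose S' : {sigma_finite_measure set (k.+1.-tuple R) -> \bar R} :=
  HB.pack (@lebesgue_tuple R k.+1) M S.
by exists S'.
Qed.

Variable m : nat.

Let lebesgue_tuple0 : @lebesgue_tuple R m set0 = 0.
Proof.
by have [mu ->] := lebesgue_tuple_sigma_finite_measure m; exact: measure0.
Qed.

Let lebesgue_tuple_ge0 A : 0 <= @lebesgue_tuple R m A.
Proof.
by have [mu ->] := lebesgue_tuple_sigma_finite_measure m; exact: measure_ge0.
Qed.

Let lebesgue_tuple_sigma_additive : semi_sigma_additive (@lebesgue_tuple R m).
Proof.
have [mu ->] := lebesgue_tuple_sigma_finite_measure m.
exact: measure_semi_sigma_additive.
Qed.

HB.instance Definition _ := isMeasure.Build _ _ _ (@lebesgue_tuple R m)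
  lebesgue_tuple0 lebesgue_tuple_ge0 lebesgue_tuple_sigma_additive.

Let lebesgue_tuple_sigma_finite : sigma_finite setT (@lebesgue_tuple R m).
Proof.
have [mu ->] := lebesgue_tuple_sigma_finite_measure m; exact: sigma_finiteT.
Qed.

HB.instance Definition _ := Measure_isSigmaFinite.Build _ _ _
  (@lebesgue_tuple R m) lebesgue_tuple_sigma_finite.

End lebesgue_tuple_measure.

Definition row_of_tuple {R : realType} {m : nat} (t : m.-tuple R) : 'rV[R]_m :=
  \row_i tnth t i.

(* The integrand is the minimal section of the subdifferential of a finite
   convex function, hence a pointwise limit of continuous maps (Moreau-Yosida);
   being Borel and bounded, it needs no completion of [lebesgue_tuple]. *)
Definition steiner {R : realType} {m : nat} (K : set 'rV[R]_m) : 'rV[R]_m :=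
  let B : set (m.-tuple R) := row_of_tuple @^-1` eball 0 1 in
  \row_i ((fine (lebesgue_tuple B))^-1 *
    \int[@lebesgue_tuple R m]_(t in B)
      min_norm_elt (subdifferential (support_fun K) (row_of_tuple t)) 0 i).

(* Measurability for the Lebesgue sigma-algebra (Borel sets up to null sets)
   on the source and the Borel sigma-algebra on the target. *)
Definition lebesgue_measurable_fun {R : realType} (D : set R) (g : R -> R) :=
  measurable_fun
    (D : set (g_sigma_algebraType (completed_algebra_gen (@lebesgue_measure R))))
    g.

(* Functions on [0, T] and on [0, +oo[ are total functions that are only
   constrained on these sets. *)
Definition modulus {R : realType} (T : R) (w : R -> R -> R) : Prop :=
  [/\ forall t r, t \in `[0, T] -> 0 <= r -> 0 <= w t r,
      forall r, 0 <= r -> lebesgue_measurable_fun `[0, T] (w ^~ r) &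
      forall t, t \in `[0, T] ->
        [/\ forall r s, 0 <= r -> r <= s -> w t r <= w t s,
            {within `[0, +oo[, continuous (w t)},
            forall r s, 0 <= r -> 0 <= s -> w t (r + s) <= w t r + w t s &
            w t 0 = 0]].

Definition admissible {R : realType} {n : nat} (T : R)
    (H : R -> 'rV[R]_n -> 'rV[R]_n -> R) : Prop :=
  [/\ forall x p, lebesgue_measurable_fun `[0, T] (fun t => H t x p),
      forall t, t \in `[0, T] ->
        continuous (fun z : 'rV[R]_n * 'rV[R]_n => H t z.1 z.2),
      forall t x, t \in `[0, T] -> convex_function setT (H t x) &
      forall r, 0 < r -> exists (k : R -> R) (w : R -> R -> R) (N : set R),
        [/\ lebesgue_measurable_fun `[0, T] k,
            forall t, t \in `[0, T] -> 0 <= k t,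
            modulus T w,
            lebesgue_measure.-negligible N &
            forall t x y p, t \in `[0, T] -> ~ N t ->
              eball 0 r x -> eball 0 r y ->
              `|H t x p - H t y p| <=
                k t * enorm p * enorm (x - y) + w t (enorm (x - y))]].

Section representation.
Context {R : realType} {n : nat} (H : R -> 'rV[R]_n -> 'rV[R]_n -> R).
Implicit Types (t : R) (x v : 'rV[R]_n) (a : 'rV[R]_(n + 1)).

Definition lagrangian t x v : \bar R :=
  ereal_sup [set (dot v p - H t x p)%:E | p in setT].

(* A pair (v, eta) of R^n x R is encoded as a row z of 'rV_(n + 1):
   v = lsubmx z and eta = rsubmx z 0 0. *)
Definition lagrangian_epi t x : set 'rV[R]_(n + 1) :=
  [set z | (lagrangian t x (lsubmx z) <= (rsubmx z 0 0)%:E)%E].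

Definition canon_e t x a : 'rV[R]_(n + 1) :=
  let E := lagrangian_epi t x in steiner (E `&` eball a (2 * edist a E)).

Definition canon_f t x a : 'rV[R]_n := lsubmx (canon_e t x a).

Definition canon_l t x a : R := rsubmx (canon_e t x a) 0 0.

End representation.

(* Main.v *)
Require Import Defs.
From HB Require Import structures.
From mathcomp Require Import all_boot all_order all_algebra.
From mathcomp Require Import all_classical all_reals all_analysis.
From mathcomp Require Import zify ring lra measurable_realfun.

Set Implicit Arguments.
Unset Strict Implicit.
Unset Printing Implicit Defensive.
Import Order.TTheory GRing.Theory Num.Theory.
Import numFieldNormedType.Exports.
Local Open Scope classical_set_scope.
Local Open Scope ring_scope.

(** The canonical representation is a composite of three maps, each of which is
    Lipschitz with a constant depending on the dimension only, so a uniform bound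
    on the Hamiltonians passes through to [canon_e].

    - Hamiltonian to epigraph of the Lagrangian ([conj_epi_excess]).  If two
      finite convex functions differ by at most [e (1 + |p|)], the epigraphs of
      their conjugates lie within [2 e] of each other.  A point of one epigraph,
      lifted by [e], is projected on the other one; the normal at the projection
      is a momentum at which the two functions are compared.  The only duality
      used is that a finite convex function is the supremum of its affine
      minorants ([conj_epi_sup]), which also comes from a projection.

    - Epigraph to truncation ([truncation_excess]).  The radius of the
      truncating ball is twice the distance to the set, so the nearest point is
      only half way out, and points just outside the ball can be pulled back
      into it at a cost proportional to their excess.

    - Convex body to Steiner point ([steiner_lipschitz]).  The bodies are
      unbounded as [a] varies, so the constant must not see their size.  The
      Steiner point averages over the unit ball the gradient of the support
      function.  On a line parallel to the [i]-th axis, the [i]-th coordinate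
      of any subgradient selection is a subgradient of a convex function of one
      variable, so its integral over the chord is a difference of two values of
      the support function ([slice_integral]).  By Tonelli, two Steiner
      points differ by an average of differences of support functions on the
      unit sphere, hence by a multiple of the Hausdorff distance.

    Tonelli requires the minimal section of the subdifferential to be Borel.  For
    a support function the Moreau-Yosida approximations of that section are the
    maps [p |-> proj_K (k p)], which are Lipschitz; their pointwise convergence
    is [cvg_proj_min_section].

    The growth bound on [canon_f] follows because the Steiner point of a convex
    body belongs to it ([steiner_in]), and because the conjugate of a function
    with Lipschitz constant [c] is infinite outside the ball of radius [c]
    ([conj_epi_lipschitz]). *)

(** * Euclidean geometry *)

Lemma closed_sublevel (R : realType) (U : topologicalType) (f : U -> R) (c : R) :
  continuous f -> closed [set x | f x <= c].
Proof.
move=> cf; apply: (@preimage_closed _ _ f [set t | t <= c]) => [x _|].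
  exact: cf.
exact: closed_le.
Qed.

Section euclidean_geometry.
Context {R : realType} {m : nat}.
Implicit Types (x y z p : 'rV[R]_m) (K : set 'rV[R]_m) (c l : R).

Lemma dotC x y : dot x y = dot y x.
Proof. by apply: eq_bigr => i _; rewrite mulrC. Qed.

Lemma dotDl x y z : dot (x + y) z = dot x z + dot y z.
Proof. by rewrite -big_split; apply: eq_bigr => i _ /=; rewrite !mxE mulrDl. Qed.

Lemma dotDr x y z : dot x (y + z) = dot x y + dot x z.
Proof. by rewrite dotC dotDl !(dotC _ x). Qed.

Lemma dotZl c x y : dot (c *: x) y = c * dot x y.
Proof. by rewrite mulr_sumr; apply: eq_bigr => i _; rewrite mxE mulrA. Qed.

Lemma dotZr c x y : dot x (c *: y) = c * dot x y.
Proof. by rewrite dotC dotZl dotC. Qed.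

Lemma dotNl x y : dot (- x) y = - dot x y.
Proof. by rewrite -scaleN1r dotZl mulN1r. Qed.

Lemma dotNr x y : dot x (- y) = - dot x y.
Proof. by rewrite dotC dotNl dotC. Qed.

Lemma dot0l x : dot 0 x = 0.
Proof. by rewrite -(scale0r 0) dotZl mul0r. Qed.

Lemma dot0r x : dot x 0 = 0.
Proof. by rewrite dotC dot0l. Qed.

Definition dotE := (dotDl, dotDr, dotNl, dotNr, dotZl, dotZr).

Lemma dot_ge0 x : 0 <= dot x x.
Proof. by apply: sumr_ge0 => i _; exact: sqr_ge0. Qed.

Lemma enorm_ge0 x : 0 <= enorm x.
Proof. exact: sqrtr_ge0. Qed.

Lemma sqr_enorm x : enorm x ^+ 2 = dot x x.
Proof. by rewrite sqr_sqrtr ?dot_ge0. Qed.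

Lemma dotxx x : dot x x = enorm x * enorm x.
Proof. by rewrite -expr2 sqr_enorm. Qed.

Lemma enorm_le x c : 0 <= c -> dot x x <= c ^+ 2 -> enorm x <= c.
Proof. by move=> c0 xc; rewrite -(ler_pXn2r (n := 2)) ?nnegrE ?enorm_ge0// sqr_enorm. Qed.

Lemma coord_le_enorm x i : `|x 0 i| <= enorm x.
Proof.
rewrite -(ler_pXn2r (n := 2)) ?nnegrE ?enorm_ge0// sqr_enorm real_normK ?num_real//.
rewrite /dot (bigD1 i)//= expr2 lerDl; apply: sumr_ge0 => j _; exact: sqr_ge0.
Qed.

Lemma enorm_eq0 x : enorm x = 0 -> x = 0.
Proof.
move=> x0; apply/rowP => i; rewrite mxE; apply/eqP.
by rewrite -normr_le0 -x0 coord_le_enorm.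
Qed.

Lemma enorm0 : enorm (0 : 'rV[R]_m) = 0.
Proof. by rewrite /enorm dot0l sqrtr0. Qed.

Lemma enormZ c x : enorm (c *: x) = `|c| * enorm x.
Proof.
by rewrite /enorm dotZl dotZr mulrA sqrtrM ?sqr_ge0 -?expr2 ?sqrtr_sqr.
Qed.

Lemma enormN x : enorm (- x) = enorm x.
Proof. by rewrite /enorm dotNl dotNr opprK. Qed.

Lemma enormB x y : enorm (x - y) = enorm (y - x).
Proof. by rewrite -enormN opprB. Qed.

Lemma dot_le_enorm x y : dot x y <= enorm x * enorm y.
Proof.
have x0 := enorm_ge0 x; have y0 := enorm_ge0 y.
have [xy0|xy0] := ltP 0 (enorm x * enorm y).
  have := dot_ge0 (enorm y *: x - enorm x *: y).
  rewrite !dotE (dotC y x) !dotxx; set a := enorm x in x0 xy0 *; set b := enorm y in y0 xy0 *.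
  move=> h; rewrite -(ler_pM2l xy0); nra.
have : (enorm x == 0) || (enorm y == 0).
  by rewrite -mulf_eq0 eq_le xy0 mulr_ge0.
by case/orP => /eqP /enorm_eq0 ->; rewrite ?dot0l ?dot0r mulr_ge0// enorm_ge0.
Qed.

Lemma enormD x y : enorm (x + y) <= enorm x + enorm y.
Proof.
apply: enorm_le; first by rewrite addr_ge0// enorm_ge0.
rewrite !dotE (dotC y x) !dotxx; have := dot_le_enorm x y; nra.
Qed.

Lemma enorm_triangle z x y : enorm (x - y) <= enorm (x - z) + enorm (z - y).
Proof. by rewrite -[x in X in X <= _](subrK z) -addrA enormD. Qed.

Lemma enorm_le_sum_coord x : enorm x <= \sum_i `|x 0 i|.
Proof.
apply: enorm_le; first by apply: sumr_ge0.
rewrite expr2 mulr_suml; apply: ler_sum => i _.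
rewrite (le_trans (ler_norm _))// normrM ler_wpM2l// (bigD1 i)//= lerDl; exact: sumr_ge0.
Qed.

Lemma dot_continuous x : continuous (dot x).
Proof.
apply: (@continuous_big _ _ +%R) => [|i _ y]; first exact: add_continuous.
by apply: cvgMl_tmp => [|]; [exact: nbhs_filter|exact: coord_continuous].
Qed.

Lemma enorm_continuous : continuous (@enorm R m).
Proof.
move=> y; apply: continuous_comp; last exact: sqrt_continuous.
move: y; apply: (@continuous_big _ _ +%R) => [|i _ y]; first exact: add_continuous.
by apply: continuousM; exact: coord_continuous.
Qed.

Lemma convex_setP K :
  convex_set K <-> forall x y l, 0 <= l -> l <= 1 -> K x -> K y -> K (x + l *: (y - x)).
Proof.
split=> cK x y l.
  move=> l0 l1 Kx Ky.
  have l01 : Itv.spec (@Itv.num_sem _) (Itv.Real `[0%Z, 1%Z]) l.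
    by rewrite /Itv.spec/= /Itv.num_sem num_real/= in_itv/= l0.
  have := cK y x (Itv.mk l01); rewrite !inE => /(_ Ky Kx).
  suff -> : x + l *: (y - x) = convex.conv (Itv.mk l01) (y : convex_lmodType _) x by [].
  rewrite /convex.conv /=.
  by rewrite /unstable.onem scalerBl scale1r scalerBr addrCA.
rewrite !inE => Kx Ky.
have := cK y x l%:num; rewrite ge0 le1 => /(_ isT isT Ky Kx).
suff -> : y + l%:num *: (x - y) = convex.conv l (x : convex_lmodType _) y by [].
rewrite /convex.conv /=.
by rewrite /unstable.onem scalerBl scale1r scalerBr addrCA.
Qed.

Lemma bounded_enorm_compact K c :
  closed K -> (forall x, K x -> enorm x <= c) -> compact K.
Proof.
move=> clK Kc; apply: bounded_closed_compact => //.
exists c; split; first exact: num_real.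
move=> d cd x Kx /=; rewrite (_ : `|x| = mx_norm x)// mx_normrE.
apply: bigmax_le => /=; first by rewrite (le_trans _ (ltW cd))// (le_trans (enorm_ge0 x))// Kc.
by move=> [i j] _ /=; rewrite ord1 (le_trans (coord_le_enorm _ _))// (le_trans (Kc _ _))// ltW.
Qed.

End euclidean_geometry.

(** * Projections onto closed convex sets *)

Section projection.
Context {R : realType} {m : nat}.
Implicit Types (a b x y z p : 'rV[R]_m) (K : set 'rV[R]_m).

Lemma closed_eball a (r : R) : closed (eball a r).
Proof.
apply: closed_sublevel => y; apply: continuous_comp; last exact: enorm_continuous.
by apply: continuousB => //; exact: cst_continuous.
Qed.

(** The obtuse angle condition characterises the nearest point of a convex
    set and, unlike minimality of the distance, is linear in the competitor. *)
Definition is_proj K a z := K z /\ forall y, K y -> dot (a - z) (y - z) <= 0.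

Definition eproj K a := xget 0 (is_proj K a).

Lemma projP K a : K !=set0 -> closed K -> convex_set K -> is_proj K a (eproj K a).
Proof.
move=> [k Kk] clK /convex_setP cvxK.
suff [z zP] : exists z, is_proj K a z by exact: xgetI zP.
pose A := K `&` eball a (enorm (k - a)).
have cA : compact A.
  apply: (@bounded_enorm_compact _ _ _ (enorm (k - a) + enorm a)).
    by apply: closedI => //; exact: closed_eball.
  by move=> x [_ xa]; rewrite -[x](subrK a) (le_trans (enormD _ _))// lerD2r.
have A0 : A !=set0 by exists k; split=> //; rewrite /eball/=.
have [z /set_mem[Kz za] zmin] : exists2 z, z \in A &
    forall y, y \in A -> enorm (z - a) <= enorm (y - a).
  apply: EVT_min_rV => //; apply: continuous_subspaceT => y.
  apply: continuous_comp; last exact: enorm_continuous.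
  by apply: continuousB => //; exact: cst_continuous.
(* outside the ball that was cut out, distances are larger anyway *)
have {}zmin y : K y -> enorm (z - a) <= enorm (y - a).
  move=> Ky; have [ya|/ltW ya] := leP (enorm (y - a)) (enorm (k - a)).
    by apply: zmin; rewrite inE.
  exact: le_trans za ya.
exists z; split=> // y Ky; rewrite leNgt; apply/negP => d0.
set d := dot _ _ in d0; set N := dot (y - z) (y - z).
have N0 : 0 <= N by exact: dot_ge0.
have dN : 0 < d + N by rewrite ltr_pwDl.
(* a step short enough for the first-order gain 2 l d to beat the second-order
   loss l^2 N *)
pose l := d / (d + N).
have l0 : 0 < l by rewrite divr_gt0.
have l1 : l <= 1 by rewrite ler_pdivrMr// mul1r lerDl.
have := zmin _ (cvxK z y l (ltW l0) l1 Kz Ky).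
rewrite -(ler_pXn2r (n := 2)) ?nnegrE ?enorm_ge0// !sqr_enorm addrAC.
have dE : d = - dot (z - a) (y - z) by rewrite -dotNl opprB.
rewrite !(dotDl (z - a)) !(dotDr _ (z - a)) !dotZl !dotZr (dotC _ (z - a)) -/N.
have lN : l * (d + N) = d by rewrite divfK// gt_eqF.
by nra.
Qed.

Section closed_convex.
Variable K : set 'rV[R]_m.
Hypotheses (K0 : K !=set0) (clK : closed K) (cvxK : convex_set K).

Lemma proj_in a : K (eproj K a).
Proof. by have [] := projP a K0 clK cvxK. Qed.

Lemma proj_obtuse a y : K y -> dot (a - eproj K a) (y - eproj K a) <= 0.
Proof. by have [_] := projP a K0 clK cvxK; exact. Qed.

Lemma proj_nearest a y : K y -> enorm (a - eproj K a) <= enorm (a - y).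
Proof.
move=> /(proj_obtuse a); set z := eproj K a => h.
apply: enorm_le; first exact: enorm_ge0.
rewrite sqr_enorm -(subrKA z a (- y)) -[z - y]opprB.
move: (a - z) (y - z) h => u v; rewrite !dotE (dotC v u) => h.
by have := dot_ge0 v; lra.
Qed.

Lemma proj_nonexpansive a b : enorm (eproj K a - eproj K b) <= enorm (a - b).
Proof.
set u := eproj K a; set v := eproj K b.
have h : dot (u - v) (u - v) <= dot (a - b) (u - v).
  have := proj_obtuse a (proj_in b); have := proj_obtuse b (proj_in a).
  rewrite -/u -/v !dotE (dotC v u); lra.
have [->|uv] := eqVneq (enorm (u - v)) 0; first exact: enorm_ge0.
have uv0 : 0 < enorm (u - v) by rewrite lt_neqAle eq_sym uv enorm_ge0.
by rewrite -(ler_pM2r uv0) -dotxx (le_trans h)// dot_le_enorm.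
Qed.

Lemma edistE a : Defs.edist a K = enorm (a - eproj K a).
Proof.
apply/eqP; rewrite eq_le; apply/andP; split.
  apply: ge_inf; last by exists (eproj K a) => //; exact: proj_in.
  by exists 0 => _ [z _ <-]; exact: enorm_ge0.
apply: lb_le_inf.
  by have [k Kk] := K0; exists (enorm (a - k)); exists k.
by move=> _ [z Kz <-]; exact: proj_nearest.
Qed.

End closed_convex.

End projection.

(** * Support functions and minimal sections *)

Section convex_body.
Context {R : realType} {m : nat}.
Implicit Types (p q v w x y : 'rV[R]_m) (K D : set 'rV[R]_m).

Definition convex_body K := [/\ K !=set0, compact K & convex_set K].

Lemma convex_body_closed K : convex_body K -> closed K.
Proof. by move=> [_ cK _]; apply: compact_closed => //; exact: norm_hausdorff. Qed.

Lemma convex_body_bounded K : convex_body K -> exists M, forall x, K x -> enorm x <= M.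
Proof.
move=> [K0 cK _].
have [|c _ h] := EVT_max_rV K0 cK (f := @enorm R m).
  exact/continuous_subspaceT/enorm_continuous.
by exists (enorm c) => x Kx; apply: h; rewrite inE.
Qed.

Lemma support_attained K p : convex_body K ->
  exists x, [/\ K x, dot p x = support_fun K p & forall y, K y -> dot p y <= dot p x].
Proof.
move=> [K0 cK _].
have [|c /set_mem Kc h] := EVT_max_rV K0 cK (f := dot p).
  exact/continuous_subspaceT/dot_continuous.
have {}h y : K y -> dot p y <= dot p c by move=> Ky; apply: h; rewrite inE.
exists c; split=> //; apply/eqP; rewrite eq_le; apply/andP; split.
  by apply: ub_le_sup; [exists (dot p c) => _ [y /h ? <-]|exists c].
by apply: ge_sup; [exists (dot p c), c|move=> _ [y /h ? <-]].
Qed.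

Lemma le_support K p x : convex_body K -> K x -> dot p x <= support_fun K p.
Proof. by move=> /(support_attained p)[c [_ <- h]] /h. Qed.

Lemma support_funD K p w (r : R) : convex_body K -> 0 <= r ->
  support_fun K (p + r *: w) <= support_fun K p + r * support_fun K w.
Proof.
move=> cK r0; have [x [Kx <- _]] := support_attained (p + r *: w) cK.
by rewrite dotDl dotZl lerD// ?ler_wpM2l// le_support.
Qed.

Lemma support_fun0 K : convex_body K -> support_fun K 0 = 0.
Proof. by move=> /(support_attained 0)[x [_ <- _]]; rewrite dot0l. Qed.

(** One half of a bound on the Hausdorff distance. *)
Definition excess_le K D (e : R) :=
  forall x, K x -> exists2 y, D y & enorm (x - y) <= e.

Lemma support_excess K D (e : R) p : convex_body K -> convex_body D ->
  excess_le K D e ->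
  support_fun K p <= support_fun D p + e * enorm p.
Proof.
move=> cK cD h; have [x [Kx <- _]] := support_attained p cK.
have [y Dy xy] := h _ Kx.
rewrite -[x](subrK y) dotDr addrC lerD ?le_support//.
by rewrite (le_trans (dot_le_enorm _ _))// mulrC ler_wpM2r// enorm_ge0.
Qed.

(** Outer normals at [v] show that a subgradient at [p] lies in [K]; testing
    the subgradient inequality at the origin then puts it on the face exposed
    by [p]. *)
Lemma subdifferential_supportE K p v : convex_body K ->
  subdifferential (support_fun K) p v <-> K v /\ dot p v = support_fun K p.
Proof.
move=> cK; have [K0 _ cvxK] := cK; have clK := convex_body_closed cK.
split=> [h|[Kv pv] q]; last first.
  by rewrite -pv dotDr dotNr (dotC v p) addrC subrK dotC le_support.
have vle w : dot v w <= support_fun K w.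
  have := h (p + w); have := @support_funD K p w 1 cK ler01.
  by rewrite scale1r mul1r (addrAC p) subrr add0r; lra.
have Kv : K v.
  set z := eproj K v; have : dot (v - z) (v - z) <= 0.
    have [x [Kx xE _]] := support_attained (v - z) cK.
    have := proj_obtuse K0 clK cvxK v Kx; have := vle (v - z).
    rewrite -xE -/z; have : v = (v - z) + z by rewrite subrK.
    move: (v - z) => u ->; rewrite dotDl dotDr dotNr (dotC z u); lra.
  move=> uu; have /eqP : enorm (v - z) = 0.
    apply/eqP; rewrite -sqrf_eq0 sqr_enorm eq_le uu dot_ge0//.
  move=> /eqP/enorm_eq0/eqP; rewrite subr_eq0 => /eqP ->; exact: proj_in.
split=> //; apply/eqP; rewrite eq_le le_support//=.
by have := h 0; rewrite support_fun0// sub0r dotNr dotC subr_le0.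
Qed.

Section minimal_section.
Variables (K : set 'rV[R]_m) (p : 'rV[R]_m).
Hypothesis cK : convex_body K.

Let face := [set v | K v /\ dot p v = support_fun K p].

Lemma face_convex_body : convex_body face.
Proof.
have [K0 coK /convex_setP cvxK] := cK; have clK := convex_body_closed cK.
split.
- by have [x [Kx px _]] := support_attained p cK; exists x.
- apply: (subclosed_compact _ coK) => [|x []//].
  have -> : face = K `&` [set x | - dot p x <= - support_fun K p].
    apply/seteqP; split=> x /= [Kx xp]; split=> //.
      by rewrite lerN2 xp.
    by apply/eqP; rewrite eq_le le_support//= -lerN2.
  apply: closedI => //; apply: closed_sublevel => y.
  by apply: continuousN; exact: dot_continuous.
- apply/convex_setP => x y l l0 l1 [Kx px] [Ky py]; split; first exact: cvxK.
  by rewrite !dotE px py; ring.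
Qed.

Definition min_section := min_norm_elt (subdifferential (support_fun K) p).

Lemma min_sectionE : min_section = eproj face 0.
Proof.
have cF := face_convex_body; have [F0 _ cvxF] := cF.
have clF := convex_body_closed cF.
have Fz := proj_in F0 clF cvxF 0; have zF := proj_obtuse F0 clF cvxF 0.
set z := eproj _ _ in Fz zF *.
rewrite /min_section /min_norm_elt.
apply: xget_unique; first split.
- exact/subdifferential_supportE.
- move=> u /(subdifferential_supportE _ _ cK) Fu.
  by have := proj_nearest F0 clF cvxF 0 Fu; rewrite !sub0r !enormN.
- move=> y [/(subdifferential_supportE _ _ cK) Fy ymin].
  have := zF _ Fy; have := ymin z; rewrite subdifferential_supportE// => /(_ Fz).
  rewrite -(ler_pXn2r (n := 2)) ?nnegrE ?enorm_ge0// !sqr_enorm => yz zy.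
  apply/eqP; rewrite -subr_eq0; apply/eqP/enorm_eq0/eqP.
  rewrite -sqrf_eq0 sqr_enorm eq_le dot_ge0 andbT.
  by move: zy; rewrite sub0r !dotE (dotC y z); lra.
Qed.

Lemma min_section_in : K min_section.
Proof.
by rewrite min_sectionE; have [F0 _ cvxF] := face_convex_body;
  have [] := proj_in F0 (convex_body_closed face_convex_body) cvxF 0.
Qed.

Lemma min_section_subgradient q :
  support_fun K p + dot min_section (q - p) <= support_fun K q.
Proof.
rewrite min_sectionE; have [F0 _ cvxF] := face_convex_body.
have := proj_in F0 (convex_body_closed face_convex_body) cvxF 0.
by move=> /(subdifferential_supportE _ _ cK); exact.
Qed.

(** The Moreau-Yosida gradients of a support function are projections:
    [eproj K (k p)] maximises [<p, x> - |x|^2 / (2 k)] over [K], so it is almost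
    on the face exposed by [p] while never being longer than the shortest
    element of that face. *)
Lemma cvg_proj_min_section :
  enorm (min_section - eproj K (k%:R *: p)) @[k --> \oo] --> (0 : R).
Proof.
have cF := face_convex_body; have [F0 _ cvxF] := cF.
have clF := convex_body_closed cF.
have zF := proj_obtuse F0 clF cvxF 0; have [Kz pz] := proj_in F0 clF cvxF 0.
rewrite min_sectionE; set z := eproj face 0 in zF Kz pz *.
have [K0 coK cvxK] := cK; have clK := convex_body_closed cK.
pose x k := eproj K (k%:R *: p).
have Kx k : K (x k) by exact: proj_in.
have xz k : 0 <= dot (x k) (z - x k) /\
    k%:R * (support_fun K p - dot p (x k)) <= dot z z.
  have := proj_obtuse K0 clK cvxK (k%:R *: p) Kz; rewrite -/(x k).
  have k0 : 0 <= k%:R :> R by [].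
  have := le_support p cK (Kx k); rewrite -pz.
  have := dot_ge0 (z - x k); have := dot_ge0 (x k).
  rewrite !dotE (dotC z (x k)); move: k0; set c := k%:R; nra.
have xz2 k : enorm (z - x k) ^+ 2 <= dot z (z - x k).
  by rewrite sqr_enorm; have := (xz k).1; rewrite !dotE (dotC z (x k)); lra.
apply/cvgrPdist_le => e e0.
(* away from the minimal-norm point, in the direction of that point, the
   linear form stays a definite amount below its maximum *)
have [g g0 gP] : exists2 g : R, 0 < g & forall y, K y ->
    support_fun K p - g < dot p y -> dot z (z - y) < e ^+ 2.
  pose A := K `&` [set y | dot z (y - z) <= - e ^+ 2].
  have [A0|A0] := pselect (A !=set0); last first.
    exists 1 => // y Ky _; rewrite ltNge; apply/negP => zy; apply: A0; exists y.
    by split=> //=; rewrite -opprB dotNr lerN2.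
  have coA : compact A.
    apply: (subclosed_compact _ coK) => [|y []//].
    apply: closedI => //; apply: closed_sublevel => y.
    apply: continuous_comp; last exact: dot_continuous.
    by apply: continuousB => //; exact: cst_continuous.
  have [|c /set_mem[Kc zc] cmax] := EVT_max_rV A0 coA (f := dot p).
    exact/continuous_subspaceT/dot_continuous.
  exists (support_fun K p - dot p c).
    rewrite subr_gt0 lt_neqAle le_support// andbT; apply/eqP => pc.
    have := zF c (conj Kc pc); rewrite sub0r dotNl oppr_le0 => /le_trans/(_ zc).
    by rewrite leNgt oppr_lt0 exprn_gt0.
  move=> y Ky; rewrite opprB addrCA subrr addr0 => cy; rewrite ltNge; apply/negP => zy.
  suff : dot p y <= dot p c by rewrite leNgt cy.
  by apply: cmax; rewrite inE; split=> //=; rewrite -opprB dotNr lerN2.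
near=> k.
rewrite sub0r normrN ger0_norm ?enorm_ge0//.
rewrite -(ler_pXn2r (n := 2)) ?nnegrE ?enorm_ge0 ?(ltW e0)//.
apply: (le_trans (xz2 k)); apply/ltW/gP => //.
have k0 : 0 < k%:R :> R by near: k; exact: nbhs_infty_gtr.
rewrite ltrBlDl -ltrBlDr -(ltr_pM2l k0) (le_lt_trans (xz k).2)//.
rewrite -ltr_pdivrMr//.
by near: k; exact: nbhs_infty_gtr.
Unshelve. all: by end_near. Qed.

End minimal_section.
End convex_body.

(** * Integration on tuples *)

Section lebesgue_tuple_integral.
Context {R : realType}.
Local Open Scope ereal_scope.

Lemma measurable_tuple_of (d : measure_display) (X : measurableType d) k
    (f : X -> k.-tuple R) :
  (forall i, measurable_fun setT (fun x => tnth (f x) i)) -> measurable_fun setT f.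
Proof. by move=> mf; apply/measurable_fun_tnthP => i; exact: mf. Qed.

Lemma measurable_coord k (i : 'I_k) :
  measurable_fun setT (fun t : k.-tuple R => tnth t i).
Proof. exact: measurable_tnth. Qed.

Lemma lebesgue_tuple_cons k (G : k.+1.-tuple R -> \bar R) :
  measurable_fun setT G -> (forall t, 0 <= G t) ->
  \int[@lebesgue_tuple R k.+1]_t G t =
  \int[lebesgue_measure]_x \int[@lebesgue_tuple R k]_t G [tuple of x :: t].
Proof.
move=> mG G0.
pose c (z : measurableTypeR R * k.-tuple R) : k.+1.-tuple R := [tuple of z.1 :: z.2].
have mc : measurable_fun setT c.
  by apply: measurable_cons; [exact: measurable_fst|exact: measurable_snd].
pose P := (@lebesgue_measure R \x @lebesgue_tuple R k)%E.
have E A : @lebesgue_tuple R k.+1 A = pushforward P c A.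
  rewrite /pushforward /P /= /product_measure1; apply: eq_integral => x _ /=.
  congr (lebesgue_tuple _); apply/seteqP; split => y /=; rewrite /xsection /= inE; exact.
rewrite (eq_measure_integral (pushforward P c)) => [|A _ _]; last exact: E.
rewrite ge0_integral_pushforward// preimage_setT /P fubini_tonelli1//.
  exact: measurableT_comp.
by move=> z; exact: G0.
Qed.

Definition insert_coord k (i : 'I_k.+1) (s : R) (t : k.-tuple R) : k.+1.-tuple R :=
  [tuple (if unlift i j is Some j' then tnth t j' else s) | j < k.+1].

Lemma insert_coord0 k (s : R) (t : k.-tuple R) :
  insert_coord ord0 s t = [tuple of s :: t].
Proof.
apply: eq_from_tnth => j; rewrite tnth_mktuple.
by case: unliftP => [j'|] ->; rewrite ?tnthS ?tnth0.
Qed.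

Lemma insert_coord_lift k (i : 'I_k.+1) (x s : R) (t : k.-tuple R) :
  insert_coord (lift ord0 i) s [tuple of x :: t] =
  [tuple of x :: insert_coord i s t].
Proof.
apply: eq_from_tnth => j; rewrite tnth_mktuple.
case: (unliftP ord0 j) => [j'|] ->; last first.
  rewrite tnth0; case: unliftP => [l|] /(congr1 val) //=.
  move=> l0; have -> : l = ord0 by apply: val_inj; move: l0; rewrite /= /bump; lia.
  by rewrite tnth0.
rewrite tnthS tnth_mktuple.
case: (unliftP i j') => [l|] ->; last by rewrite unlift_none.
have -> : lift ord0 (lift i l) = lift (lift ord0 i) (lift ord0 l).
  by apply: val_inj; rewrite /= /bump /=; lia.
by rewrite liftK tnthS.
Qed.

Lemma measurable_insert_coord k (i : 'I_k.+1) :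
  measurable_fun setT
    (fun z : k.-tuple R * measurableTypeR R => insert_coord i z.2 z.1).
Proof.
apply: measurable_tuple_of => j.
have [l jl|ji] := unliftP i j.
  rewrite (_ : (fun _ => _) = (fun t : k.-tuple R => tnth t l) \o fst).
    by apply: measurableT_comp => //; exact: measurable_coord.
  by apply/funext => z /=; rewrite tnth_mktuple jl liftK.
rewrite (_ : (fun _ => _) = snd)//.
by apply/funext => z /=; rewrite tnth_mktuple ji unlift_none.
Qed.

(** The measure is defined by slicing along the first coordinate: the other
    coordinates are reached by induction, and integrals are only exchanged when
    [i] is the first one. *)
Lemma lebesgue_tuple_insert k (i : 'I_k.+1) (G : k.+1.-tuple R -> \bar R) :
  measurable_fun setT G -> (forall t, 0 <= G t) ->
  \int[@lebesgue_tuple R k.+1]_t G t =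
  \int[@lebesgue_tuple R k]_t \int[lebesgue_measure]_s G (insert_coord i s t).
Proof.
elim: k i G => [|k IH] i G mG G0.
  rewrite ord1 lebesgue_tuple_cons//.
  rewrite (@fubini_tonelli _ _ _ _ R lebesgue_measure (@lebesgue_tuple R 0)
    (fun z => G [tuple of z.1 :: z.2])).
  - by apply: eq_integral => t _; apply: eq_integral => s _; rewrite insert_coord0.
  - apply: measurableT_comp => //.
    by apply: measurable_cons; [exact: measurable_fst|exact: measurable_snd].
  - by move=> z; exact: G0.
have [j ij|i0] := unliftP ord0 i; last first.
  rewrite i0 lebesgue_tuple_cons//.
  rewrite (@fubini_tonelli _ _ _ _ R lebesgue_measure (@lebesgue_tuple R k.+1)
    (fun z => G [tuple of z.1 :: z.2])).
  - by apply: eq_integral => t _; apply: eq_integral => s _; rewrite insert_coord0.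
  - apply: measurableT_comp => //.
    by apply: measurable_cons; [exact: measurable_fst|exact: measurable_snd].
  - by move=> z; exact: G0.
have mGi : measurable_fun setT (fun z : k.+1.-tuple R * measurableTypeR R =>
    G (insert_coord i z.2 z.1)).
  by apply: measurableT_comp => //; exact: measurable_insert_coord.
rewrite [RHS]lebesgue_tuple_cons; first last.
- by move=> t; apply: integral_ge0 => s _; exact: G0.
- have F0 z : 0 <= G (insert_coord i z.2 z.1) by exact: G0.
  exact: (measurable_fun_fubini_tonelli_F (m2 := lebesgue_measure) _ mGi F0).
rewrite lebesgue_tuple_cons//; apply: eq_integral => x _.
rewrite (IH j (fun t => G [tuple of x :: t]))//.
  apply: eq_integral => t _; apply: eq_integral => s _.
  by rewrite ij insert_coord_lift.
by apply: measurableT_comp => //; apply: measurable_cons; [exact: measurable_cst|exact: measurable_id].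
Qed.

Lemma lebesgue_tuple_cube m (d : R) : (0 <= d)%R ->
  lebesgue_tuple [set t : m.-tuple R | forall i, (`|tnth t i| <= d)%R] =
  ((2 * d) ^+ m)%:E.
Proof.
move=> d0; elim: m => [|m IH].
  by rewrite expr0 /= diracE mem_set//= => -[].
rewrite [LHS]/=.
transitivity (\int[lebesgue_measure]_(x in `[(- d)%R, d]) ((2 * d) ^+ m)%:E).
  rewrite [RHS]integral_mkcond; apply: eq_integral => x _.
  rewrite patchE; case: ifPn => [|xd].
    rewrite inE/= in_itv/= -ler_norml => xd; rewrite -IH; congr lebesgue_tuple.
    apply/seteqP; split=> y /= h i; first by have := h (lift ord0 i); rewrite tnthS.
    by have [j|] := unliftP ord0 i => ->; rewrite ?tnthS ?tnth0.
  rewrite (_ : [set _ | _] = set0) ?measure0//.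
  rewrite -subset0 => y /= /(_ ord0); rewrite tnth0 => xd'.
  by move: xd; rewrite notin_setE/= in_itv/= -ler_norml.
rewrite integral_cst//= lebesgue_measure_itv/=.
move: d0; rewrite le_eqVlt => /predU1P[<-|d0].
  by rewrite oppr0 ltxx mulr0 mule0 exprS mul0r.
by rewrite lte_fin gtrN// -EFinB -EFinM opprK exprSr mulr2n mulrDl mul1r.
Qed.

End lebesgue_tuple_integral.

(** * Measurability and the fundamental theorem for convex functions *)

Section one_dimensional.
Context {R : realType}.
Implicit Types (phi psi : R -> R) (a b s u : R).
Local Notation mu := (@lebesgue_measure R).

Section subgradient_selection.
Variables phi psi : R -> R.
Hypothesis sub : forall s u, phi s + psi s * (u - s) <= phi u.

Lemma subgradient_homo : {homo psi : s u / s <= u}.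
Proof.
move=> s u; rewrite le_eqVlt => /predU1P[->//|su].
have := sub s u; have := sub u s; nra.
Qed.

Lemma subgradient_integrable a b : mu.-integrable `[a, b] (EFin \o psi).
Proof.
apply: measurable_bounded_integrable => //.
- rewrite /= lebesgue_measure_itv/=; case: ifPn => // _; exact: ltry.
- by apply: nondecreasing_measurable => //; exact: subgradient_homo.
- exists (`|psi a| + `|psi b|); split; first exact: num_real.
  move=> M hM s /=; rewrite in_itv/= => /andP[/subgradient_homo h1 /subgradient_homo h2].
  rewrite (le_trans _ (ltW hM))// ler_norml; apply/andP; split.
    rewrite lerNl (le_trans (y := - psi a))// ?lerN2// (le_trans (ler_norm _))// normrN.
    by rewrite lerDl.
  by rewrite (le_trans h2)// (le_trans (ler_norm _))// lerDr.
Qed.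

Lemma Rintegral_split a c b : a <= c -> c <= b ->
  \int[mu]_(s in `[a, b]) psi s =
  \int[mu]_(s in `[a, c]) psi s + \int[mu]_(s in `[c, b]) psi s.
Proof.
move=> ac cb; apply/eqP; rewrite addrC -subr_eq; apply/eqP.
rewrite Rintegral_itvB ?bnd_simp//; last exact: subgradient_integrable.
rewrite Rintegral_itv_obnd_cbnd//.
apply: integrableS (subgradient_integrable c b) => //; exact: subset_itv_oc_cc.
Qed.

(** Both sides lie between [psi a * (b - a)] and [psi b * (b - a)]; bisecting
    the interval halves the resulting bound on their difference because [psi]
    is monotone, and the bounds on the two halves telescope. *)
Lemma Rintegral_subgradient_error k a b : a <= b ->
  `|\int[mu]_(s in `[a, b]) psi s - (phi b - phi a)| <=
    (psi b - psi a) * (b - a) / 2 ^+ k.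
Proof.
elim: k a b => [|k IH] a b ab.
  have fe : fine (mu `[a, b]%classic) = b - a.
    rewrite /= lebesgue_measure_itv/= lte_fin; move: ab; rewrite le_eqVlt.
    by case/predU1P => [->|->//]; rewrite ltxx subrr.
  have ci c : mu.-integrable `[a, b] (EFin \o (fun=> c : R)).
    apply: measurable_bounded_integrable => //; last exact: bounded_cst.
    by rewrite /= lebesgue_measure_itv/=; case: ifPn => // _; exact: ltry.
  have lo : psi a * (b - a) <= \int[mu]_(s in `[a, b]) psi s.
    rewrite -fe -Rintegral_cst//; apply: le_Rintegral => //.
      exact: subgradient_integrable.
    by move=> s /=; rewrite in_itv/= => /andP[/subgradient_homo].
  have hi : \int[mu]_(s in `[a, b]) psi s <= psi b * (b - a).
    rewrite -fe -Rintegral_cst//; apply: le_Rintegral => //.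
      exact: subgradient_integrable.
    by move=> s /=; rewrite in_itv/= => /andP[_ /subgradient_homo].
  have := sub a b; have := sub b a; rewrite expr0 divr1 => h1 h2.
  by rewrite ler_norml; apply/andP; split; move: h1 h2 lo hi; move: (\int[mu]_(s in `[a, b]) psi s) => I; lra.
pose c := (a + b) / 2.
have ac : a <= c by rewrite /c; lra.
have cb : c <= b by rewrite /c; lra.
rewrite (Rintegral_split ac cb).
have -> : (psi b - psi a) * (b - a) / 2 ^+ k.+1 =
    (psi c - psi a) * (c - a) / 2 ^+ k + (psi b - psi c) * (b - c) / 2 ^+ k.
  by rewrite exprS /c; field; rewrite expf_neq0.
have := IH a c ac; have := IH c b cb.
set X := Rintegral _ _ _; set Y := Rintegral _ _ _ => h1 h2.
rewrite (_ : _ - _ = (X - (phi b - phi c)) + (Y - (phi c - phi a))); last lra.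
by rewrite (le_trans (ler_normD _ _))// addrC lerD.
Qed.

Lemma integral_subgradient a b : a <= b ->
  (\int[mu]_(s in `[a, b]) (psi s)%:E = (phi b - phi a)%:E)%E.
Proof.
move=> ab; rewrite -[LHS]fineK; last first.
  by apply: integrable_fin_num => //; exact: subgradient_integrable.
congr EFin; apply/eqP; rewrite -subr_eq0 -normr_le0.
have c0 : (psi b - psi a) * (b - a) * (2^-1 ^+ k) @[k --> \oo] --> (0 : R).
  rewrite -[X in _ --> X](mulr0 ((psi b - psi a) * (b - a))).
  apply: cvgMl_tmp; apply: cvg_expr; rewrite ger0_norm; lra.
apply: (ler_cvg_to (cvg_cst _) c0).
by near=> k; rewrite exprVn; exact: Rintegral_subgradient_error.
Unshelve. all: by end_near. Qed.

End subgradient_selection.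
End one_dimensional.

Section tuple_measurability.
Context {R : realType} {m : nat}.

Lemma row_of_tupleE (t : m.-tuple R) i j : row_of_tuple t i j = tnth t j.
Proof. by rewrite mxE. Qed.

(** A Lipschitz function is the supremum, over the countably many rational
    points, of the cones it dominates. *)
Lemma measurable_lipschitz (f : 'rV[R]_m -> R) (c : R) :
  (forall x y, `|f x - f y| <= c * enorm (x - y)) ->
  measurable_fun setT (fun t : m.-tuple R => f (row_of_tuple t)).
Proof.
move=> fc.
have [L L0 fL] : exists2 L, 0 <= L & forall x y, `|f x - f y| <= L * enorm (x - y).
  exists `|c| => // x y; rewrite (le_trans (fc x y))// ler_wpM2r ?enorm_ge0//.
  exact: ler_norm.
apply: (measurability _ (RGenOInfty.measurableE R)) => //.
move=> _ [_ [a ->] <-]; rewrite setTI.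
pose r (q : m.-tuple rat) : 'rV[R]_m := \row_i ratr (tnth q i).
pose h q (t : m.-tuple R) := f (r q) - L * \sum_i `|tnth t i - ratr (tnth q i)|.
have -> : (fun t => f (row_of_tuple t)) @^-1` `]a, +oo[ =
    \bigcup_q (h q @^-1` `]a, +oo[).
  have cone q t : `|f (row_of_tuple t) - f (r q)| <=
      L * \sum_i `|tnth t i - ratr (tnth q i)|.
    rewrite (le_trans (fL _ _))// ler_wpM2l//.
    rewrite (le_trans (enorm_le_sum_coord _))// ler_sum// => i _.
    by rewrite !mxE.
  apply/seteqP; split=> t /=; rewrite ?in_itv/= ?andbT; last first.
    move=> [q _] /=; rewrite in_itv/= andbT => /lt_le_trans; apply.
    by have := cone q t; rewrite ler_norml /h => /andP[]; lra.
  (* two cones of slope [L] on coordinates known up to [d] lose 2 L m d in height *)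
  move=> aft; pose d := (f (row_of_tuple t) - a) / (2 * L * m%:R + 1).
  have d0 : 0 < d.
    by rewrite divr_gt0 ?subr_gt0// ltr_wpDl// !mulr_ge0.
  have qP i : exists q : rat, `|tnth t i - ratr q| < d.
    have [|q] := @rat_in_itvoo R (tnth t i - d) (tnth t i + d).
      by rewrite ltrD2l gtrN.
    rewrite in_itv/= => /andP[h1 h2]; exists q.
    by rewrite ltr_norml; apply/andP; split; lra.
  exists [tuple sval (cid (qP i)) | i < m] => //=; rewrite in_itv/= andbT /h.
  set q := [tuple _ | _ < m]; have := cone q t.
  have sd : \sum_i `|tnth t i - ratr (tnth q i)| <= m%:R * d.
    rewrite (le_trans (y := \sum_(i < m) d))//.
      by apply: ler_sum => i _; rewrite tnth_mktuple; case: cid => x /= /ltW.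
    by rewrite sumr_const card_ord mulr_natl.
  have dE : d * (2 * L * m%:R + 1) = f (row_of_tuple t) - a.
    by rewrite divfK// gt_eqF// ltr_wpDl// !mulr_ge0.
  rewrite ler_norml => /andP[]; have := ler_wpM2l L0 sd.
  set s := \sum_i _; nra.
apply: countable_bigcupT_measurable; first exact: countableP.
move=> q; rewrite -[X in measurable X]setTI.
suff mh : measurable_fun setT (h q) by apply: mh.
apply: measurable_funB => //; apply: measurable_funM => //.
apply: measurable_sum => i; apply: measurableT_comp => //.
by apply: measurable_funB => //; exact: measurable_coord.
Qed.

Definition unit_ball_tuple : set (m.-tuple R) := row_of_tuple @^-1` eball 0 1.

Lemma measurable_enorm_tuple :
  measurable_fun setT (fun t : m.-tuple R => enorm (row_of_tuple t)).
Proof.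
apply: (@measurable_lipschitz _ 1) => x y; rewrite mul1r ler_norml; apply/andP; split.
  by rewrite lerBrDl -lerBrDr opprK addrC enormB -{1}[y](subrK x) enormD.
by rewrite lerBlDr -{1}[x](subrK y) enormD.
Qed.

Lemma measurable_unit_ball : measurable unit_ball_tuple.
Proof.
have := measurable_enorm_tuple measurableT (@measurable_itv R `]-oo, 1]).
rewrite setTI; congr measurable; apply/seteqP; split=> t /=; rewrite in_itv/=;
  by rewrite /unit_ball_tuple /= /eball/= subr0.
Qed.

Lemma measurable_cube (d : R) :
  measurable [set t : m.-tuple R | forall i, `|tnth t i| <= d].
Proof.
rewrite (_ : [set _ | _] = \bigcap_(i in [set: 'I_m]) [set t | `|tnth t i| <= d]).
  apply: fin_bigcap_measurable => // i _.
  have mi : measurable_fun setT (fun t : m.-tuple R => `|tnth t i|).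
    by apply: measurableT_comp => //; exact: measurable_coord.
  have := mi measurableT _ (@measurable_itv R `]-oo, d]); rewrite setTI.
  by congr measurable; apply/seteqP; split=> t /=; rewrite in_itv.
by apply/seteqP; split=> t h i; [move=> _|]; exact: h.
Qed.

Lemma lebesgue_unit_ball_lty : (lebesgue_tuple unit_ball_tuple < +oo)%E.
Proof.
apply: (le_lt_trans (y := ((2 * 1) ^+ m)%:E)); last exact: ltry.
rewrite -(lebesgue_tuple_cube _ (d := 1))//.
apply: le_measure; rewrite ?inE; [exact: measurable_unit_ball|exact: measurable_cube|].
move=> t; rewrite /unit_ball_tuple /= /eball /= subr0 => t1 i.
by rewrite -(row_of_tupleE t 0) (le_trans _ t1)// coord_le_enorm.
Qed.

Lemma lebesgue_unit_ball_gt0 : (0 < lebesgue_tuple unit_ball_tuple)%E.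
Proof.
pose d : R := m.+1%:R^-1.
have d0 : 0 < d by rewrite invr_gt0.
apply: (@lt_le_trans _ _ ((2 * d) ^+ m)%:E).
  by rewrite lte_fin exprn_gt0// mulr_gt0.
rewrite -(lebesgue_tuple_cube _ (ltW d0)).
apply: le_measure; rewrite ?inE; [exact: measurable_cube|exact: measurable_unit_ball|].
move=> t /= td; rewrite /unit_ball_tuple /= /eball /= subr0.
rewrite (le_trans (enorm_le_sum_coord _))// (le_trans (y := \sum_(i < m) d))//.
  by apply: ler_sum => i _; rewrite row_of_tupleE.
rewrite sumr_const card_ord -mulr_natl /d ler_pdivrMr// mul1r ler_nat.
exact: leqnSn.
Qed.

End tuple_measurability.

(** * The Steiner point *)

Section steiner_point.
Context {R : realType}.
Local Notation lebT := (@lebesgue_tuple R _).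

Section integrands.
Context {m : nat}.
Implicit Types (K D : set 'rV[R]_m) (t : m.-tuple R).

Definition min_coord K i t : R := min_section K (row_of_tuple t) 0 i.

Lemma steinerE K i : steiner K 0 i =
  (fine (lebT (@unit_ball_tuple R m)))^-1 * \int[lebT]_(u in unit_ball_tuple) min_coord K i u.
Proof. by rewrite mxE. Qed.

Lemma measurable_min_coord K i : convex_body K -> measurable_fun setT (min_coord K i).
Proof.
move=> cK; have [K0 _ cvxK] := cK; have clK := convex_body_closed cK.
apply: (measurable_fun_cvg
    (h := fun k t => eproj K (k%:R *: row_of_tuple t) 0 i)) => [k|t _].
  apply: (@measurable_lipschitz _ _ (fun p => eproj K (k%:R *: p) 0 i) k%:R) => x y.
  have := coord_le_enorm (eproj K (k%:R *: x) - eproj K (k%:R *: y)) i.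
  rewrite !mxE => /le_trans; apply.
  rewrite (le_trans (proj_nonexpansive _ _ _ _ _))// -scalerBr enormZ.
  by rewrite ger0_norm.
have := cvg_proj_min_section (row_of_tuple t) cK.
move=> /cvgrPdist_le h; apply/cvgrPdist_le => e e0.
have := h e e0; apply: filterS => k; rewrite sub0r normrN => /le_trans h'.
have := coord_le_enorm (min_section K (row_of_tuple t) -
  eproj K (k%:R *: row_of_tuple t)) i.
rewrite !mxE => /le_trans; apply; apply: le_trans; last exact: (h' e).
exact: ler_norm.
Qed.

Lemma min_coord_le K i t (M : R) : convex_body K -> (forall x, K x -> enorm x <= M) ->
  `|min_coord K i t| <= M.
Proof.
move=> cK KM; apply: le_trans (KM _ (min_section_in (row_of_tuple t) cK)).
exact: coord_le_enorm.
Qed.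

Lemma integrable_ball (f : m.-tuple R -> R) (M : R) : measurable_fun setT f ->
  (forall t, `|f t| <= M) -> lebT.-integrable unit_ball_tuple (EFin \o f).
Proof.
move=> mf fM; apply: measurable_bounded_integrable.
- exact: measurable_unit_ball.
- exact: lebesgue_unit_ball_lty.
- exact: measurable_funTS.
- exists M; split; first exact: num_real.
  by move=> N /ltW MN t _; exact: le_trans (fM t) MN.
Qed.

Lemma integrable_min_coord K i : convex_body K ->
  lebT.-integrable unit_ball_tuple (EFin \o min_coord K i).
Proof.
move=> cK; have [M KM] := convex_body_bounded cK.
apply: (@integrable_ball _ M); first exact: measurable_min_coord.
by move=> t; exact: min_coord_le.
Qed.

Lemma ball_volume_gt0 : 0 < fine (lebT (@unit_ball_tuple R m)).
Proof. by rewrite fine_gt0// lebesgue_unit_ball_gt0 lebesgue_unit_ball_lty. Qed.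

(** An average of points of a closed convex set stays on the right side of
    every supporting hyperplane. *)
Lemma steiner_in K : convex_body K -> K (steiner K).
Proof.
move=> cK; have [K0 _ cvxK] := cK; have clK := convex_body_closed cK.
set s := steiner K; set z := eproj K s; set w := s - z.
have mB := @measurable_unit_ball R m.
have ws : dot w s <= dot w z.
  have sumI (r : seq 'I_m) :
      lebT.-integrable unit_ball_tuple (EFin \o (fun t => \sum_(i <- r) w 0 i * min_coord K i t)) /\
      \int[lebT]_(t in unit_ball_tuple) (\sum_(i <- r) w 0 i * min_coord K i t) =
      \sum_(i <- r) w 0 i * \int[lebT]_(u in unit_ball_tuple) min_coord K i u.
    have iZ i : lebT.-integrable unit_ball_tuple (EFin \o (fun t => w 0 i * min_coord K i t)).
      apply: (eq_integrable _ (fun t => (w 0 i)%:E * (min_coord K i t)%:E)%E) => //.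
      by apply: integrableZl => //; exact: integrable_min_coord.
    elim: r => [|i r [IH1 IH2]].
      rewrite big_nil; split.
        apply: (eq_integrable _ (cst 0%E)) => [//|t _|]; last exact: integrable0.
        by rewrite /= big_nil.
      by under eq_Rintegral do rewrite big_nil; rewrite Rintegral_cst// mul0r.
    split.
      apply: (eq_integrable _ ((EFin \o (fun t => w 0%R i * min_coord K i t)%R) \+
        (EFin \o (fun t => \sum_(j <- r) w 0%R j * min_coord K j t)%R))%E) => //.
        by move=> t _; rewrite /= big_cons.
      exact: integrableD.
    under eq_Rintegral do rewrite big_cons.
    rewrite RintegralD// big_cons IH2 RintegralZl//.
    exact: integrable_min_coord.
  have [i1 i2] := sumI (index_enum 'I_m).
  have -> : dot w s = (fine (lebT (@unit_ball_tuple R m)))^-1 *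
      \int[lebT]_(t in unit_ball_tuple) (dot w (min_section K (row_of_tuple t))).
    rewrite [X in _ = _ * X]i2 mulr_sumr; apply: eq_bigr => i _.
    by rewrite steinerE mulrCA.
  rewrite mulrC ler_pdivrMr ?ball_volume_gt0// -Rintegral_cst//.
  apply: le_Rintegral => //.
    apply: (@integrable_ball _ `|dot w z|); first exact: measurable_cst.
    by move=> _.
  move=> t _; have := proj_obtuse K0 clK cvxK s (min_section_in (row_of_tuple t) cK).
  by rewrite -/z -/w dotDr dotNr subr_le0.
have /eqP : enorm w = 0.
  apply/eqP; rewrite -sqrf_eq0 sqr_enorm eq_le dot_ge0 andbT.
  by move: ws; rewrite -subr_le0 -dotNr -dotDr.
move=> /eqP/enorm_eq0/eqP; rewrite subr_eq0 => /eqP ->; exact: proj_in.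
Qed.

End integrands.

Section slices.
Context {k : nat}.
Implicit Types (K D : set 'rV[R]_k.+1) (t : k.-tuple R).

Definition base_row (i : 'I_k.+1) t : 'rV[R]_k.+1 := row_of_tuple (insert_coord i 0 t).

Lemma row_of_insert_coord i s t :
  row_of_tuple (insert_coord i s t) = base_row i t + s *: delta_mx 0 i.
Proof.
apply/rowP => j; rewrite !mxE !tnth_mktuple eqxx /=.
have [l ->|->] := unliftP i j; rewrite ?liftK ?unlift_none.
  by rewrite eq_sym (negbTE (neq_lift i l)) mulr0 addr0.
by rewrite eqxx mulr1 add0r.
Qed.

Lemma dot_base_row i s t (p := base_row i t + s *: delta_mx 0 i) :
  dot p p = dot (base_row i t) (base_row i t) + s ^+ 2.
Proof.
have pd (q : 'rV[R]_k.+1) : dot q (delta_mx 0 i) = q 0 i.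
  rewrite /dot (bigD1 i)//= mxE !eqxx mulr1 big1 ?addr0// => j /negbTE ji.
  by rewrite mxE ji andbF mulr0.
have b0 : base_row i t 0 i = 0 by rewrite mxE tnth_mktuple unlift_none.
rewrite /p !dotE (dotC (delta_mx 0 i)) !pd b0 mxE !eqxx /=; ring.
Qed.

(** A bound [M] on the norms in [K] makes this nonnegative, so that Tonelli
    applies without integrability conditions. *)
Definition shifted_coord K i (M : R) : k.+1.-tuple R -> \bar R :=
  (fun u => (min_coord K i u + M)%:E) \_ unit_ball_tuple.

Lemma measurable_shifted_coord K i (M : R) : convex_body K ->
  measurable_fun setT (shifted_coord K i M).
Proof.
move=> cK; apply/(measurable_restrictT _ measurable_unit_ball).
apply: measurable_funTS; apply/measurable_EFinP; apply: measurable_funD => //.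
exact: measurable_min_coord.
Qed.

Lemma shifted_coord_ge0 K i (M : R) : convex_body K ->
  (forall x, K x -> enorm x <= M) -> forall u, (0 <= shifted_coord K i M u)%E.
Proof.
move=> cK KM u; rewrite /shifted_coord patchE; case: ifP => // _.
rewrite lee_fin; have := min_coord_le i u cK KM; rewrite ler_norml => /andP[]; lra.
Qed.

(** On a line parallel to the [i]-th axis the [i]-th coordinate of a subgradient
    is a subgradient of the restricted function, so its integral over the chord
    of the ball only sees the support function at the two end points. *)
Lemma slice_integral K i (M : R) t
    (c : R := Num.sqrt (1 - dot (base_row i t) (base_row i t))) :
  convex_body K -> dot (base_row i t) (base_row i t) <= 1 ->
  (\int[lebesgue_measure]_s shifted_coord K i M (insert_coord i s t) =
   (support_fun K (base_row i t + c *: delta_mx 0 i) -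
    support_fun K (base_row i t - c *: delta_mx 0 i) + 2 * c * M)%:E)%E.
Proof.
move=> cK b1; have c0 : 0 <= c by exact: sqrtr_ge0.
have c2 : c ^+ 2 = 1 - dot (base_row i t) (base_row i t) by rewrite sqr_sqrtr// subr_ge0.
transitivity (\int[lebesgue_measure]_(s in `[(- c)%R, c])
    (min_section K (base_row i t + s *: delta_mx 0 i) 0 i + M)%:E)%E.
  rewrite [RHS]integral_mkcond; apply: eq_integral => s _.
  rewrite /shifted_coord !patchE /min_coord row_of_insert_coord; congr (if _ then _ else _).
  have sc : (`|s| <= c) = (s ^+ 2 <= c ^+ 2).
    by rewrite -[s ^+ 2]real_normK ?num_real// ler_pXn2r// nnegrE.
  have p1 (p : 'rV[R]_k.+1) : (enorm p <= 1) = (dot p p <= 1).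
    by rewrite -sqr_enorm -[X in _ = (_ <= X)](expr1n _ 2) ler_pXn2r ?nnegrE ?enorm_ge0 ?ler01//.
  apply/idP/idP; rewrite !inE/= /unit_ball_tuple/= /eball/= subr0 row_of_insert_coord;
    by rewrite in_itv/= -ler_norml sc p1 dot_base_row c2 lerBrDl.
(* the shift by [M] is absorbed in a linear term, which keeps the subgradient
   inequality *)
pose phi s := support_fun K (base_row i t + s *: delta_mx 0 i) + M * s.
rewrite (@integral_subgradient _ phi); first 1 last.
- move=> s u; rewrite /phi.
  have := min_section_subgradient (base_row i t + s *: delta_mx 0 i) cK
     (base_row i t + u *: delta_mx 0 i).
  rewrite opprD addrACA subrr add0r -scalerBl dotZr.
  have -> : dot (min_section K (base_row i t + s *: delta_mx 0 i)) (delta_mx 0 i) =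
      min_section K (base_row i t + s *: delta_mx 0 i) 0 i.
    rewrite /dot (bigD1 i)//= [delta_mx _ _ _ _]mxE !eqxx mulr1 big1 ?addr0// => j /negbTE ji.
    by rewrite [delta_mx _ _ _ _]mxE ji andbF mulr0.
  set a := min_section _ _ _ _; set b := support_fun _ _; set d := support_fun _ _.
  by rewrite mulrDl; lra.
- by rewrite ge0_cp.
by congr EFin; rewrite /phi scaleNr; ring.
Qed.

Lemma slice_integral_out K i (M : R) t :
  1 < dot (base_row i t) (base_row i t) ->
  (\int[lebesgue_measure]_s shifted_coord K i M (insert_coord i s t) = 0)%E.
Proof.
move=> b1; apply: integral0_eq => s _; rewrite /shifted_coord patchE.
rewrite memNset// /unit_ball_tuple/= /eball/= subr0 row_of_insert_coord.
apply/negP; rewrite -ltNge -(ltr_pXn2r (n := 2)) ?nnegrE ?enorm_ge0//.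
by rewrite sqr_enorm dot_base_row expr1n ltr_wpDr ?sqr_ge0.
Qed.

(** The end points of a chord lie on the unit sphere, where the support functions
    differ by at most [e]; the chords are indexed by points of a cube of volume
    [2 ^ k]. *)
Lemma min_coord_integral_le K D i (e : R) : convex_body K -> convex_body D ->
  0 <= e -> excess_le K D e -> excess_le D K e ->
  \int[lebT]_(u in unit_ball_tuple) min_coord K i u <=
  \int[lebT]_(u in unit_ball_tuple) min_coord D i u + 2 ^+ k.+1 * e.
Proof.
move=> cK cD e0 KD DK.
have [M KM DM] : exists2 M, forall x, K x -> enorm x <= M & forall x, D x -> enorm x <= M.
  have [M KM] := convex_body_bounded cK; have [N DN] := convex_body_bounded cD.
  by exists (Num.max M N) => x /[dup] h; [move=> /KM|move=> /DN]; rewrite le_max => ->;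
    rewrite ?orbT.
have mB := @measurable_unit_ball R k.+1.
have intE C : convex_body C ->
    (\int[lebT]_u shifted_coord C i M u = (\int[lebT]_(u in unit_ball_tuple) min_coord C i u
     + M * fine (lebT (@unit_ball_tuple R k.+1)))%:E)%E.
  move=> cC; rewrite /shifted_coord -integral_mkcond.
  have iM : lebT.-integrable (@unit_ball_tuple R k.+1) (EFin \o cst M).
    by apply: (@integrable_ball _ _ `|M|) => //; exact: measurable_cst.
  have iC := integrable_min_coord i cC.
  rewrite -[LHS]fineK; last first.
    apply: integrable_fin_num => //.
    by apply: (eq_integrable _ ((EFin \o min_coord C i) \+ (EFin \o cst M))%E) => //;
      exact: integrableD.
  congr EFin; rewrite -Rintegral_cst// -RintegralD//.
pose G C t := (\int[lebesgue_measure]_s shifted_coord C i M (insert_coord i s t))%E.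
have mG C : convex_body C -> (forall x, C x -> enorm x <= M) -> measurable_fun setT (G C).
  move=> cC CM.
  have mGi : measurable_fun setT (fun z : k.-tuple R * measurableTypeR R =>
      shifted_coord C i M (insert_coord i z.2 z.1)).
    apply: measurableT_comp => //; first exact: measurable_shifted_coord.
    exact: measurable_insert_coord.
  apply: (measurable_fun_fubini_tonelli_F (m2 := lebesgue_measure) _ mGi) => z.
  exact: shifted_coord_ge0.
have G0 C : convex_body C -> (forall x, C x -> enorm x <= M) -> forall t, (0 <= G C t)%E.
  by move=> cC CM t; apply: integral_ge0 => s _; exact: shifted_coord_ge0.
pose Q := [set t : k.-tuple R | forall j, `|tnth t j| <= 1].
have mQ : measurable Q by exact: measurable_cube.
have slice t : (G K t <= G D t + (cst (2 * e)%:E \_ Q) t)%E.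
  have Q0 : (0 <= (cst (2 * e)%:E \_ Q) t)%E.
    by rewrite patchE; case: ifP => //= _; rewrite lee_fin mulr_ge0.
  have [b1|b1] := leP (dot (base_row i t) (base_row i t)) 1; last first.
    by rewrite {1}/G slice_integral_out// adde_ge0// G0.
  rewrite /G !slice_integral// patchE mem_set; last first.
    move=> j; have := coord_le_enorm (base_row i t) (lift i j).
    rewrite mxE tnth_mktuple liftK => /le_trans; apply.
    by apply: enorm_le => //; rewrite expr1n.
  rewrite -EFinD lee_fin; set c := Num.sqrt _.
  have n1 (s : R) : s ^+ 2 = 1 - dot (base_row i t) (base_row i t) ->
      enorm (base_row i t + s *: delta_mx 0 i) <= 1.
    by move=> s2; apply: enorm_le => //; rewrite dot_base_row s2 expr1n addrC subrK.
  have c2 : c ^+ 2 = 1 - dot (base_row i t) (base_row i t) by rewrite sqr_sqrtr// subr_ge0.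
  have h1 := support_excess (base_row i t + c *: delta_mx 0 i) cK cD KD.
  have h2 := support_excess (base_row i t - c *: delta_mx 0 i) cD cK DK.
  have h3 := ler_wpM2l e0 (n1 c c2).
  have := n1 (- c); rewrite sqrrN scaleNr => /(_ c2) /(ler_wpM2l e0) h4.
  by move: h1 h2 h3 h4; lra.
have le : (\int[lebT]_u shifted_coord K i M u <=
    \int[lebT]_u shifted_coord D i M u + (2 ^+ k.+1 * e)%:E)%E.
  rewrite !(lebesgue_tuple_insert i); try exact: measurable_shifted_coord; try exact: shifted_coord_ge0.
  have mcst : measurable_fun setT (cst (2 * e)%:E \_ Q).
    by apply/(measurable_restrictT _ mQ); exact: measurable_cst.
  have -> : (2 ^+ k.+1 * e)%:E = (\int[lebT]_t (cst (2 * e)%:E \_ Q) t)%E.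
    rewrite -integral_mkcond integral_cst//= /Q lebesgue_tuple_cube// mulr1 -EFinM.
    by congr EFin; rewrite exprS; ring.
  rewrite -ge0_integralD//.
  - apply: ge0_le_integral => //.
    + by move=> t _; exact: G0.
    + exact: mG.
    + by apply: emeasurable_funD => //; exact: mG.
    + by move=> t _; exact: slice.
  - by move=> t _; exact: G0.
  - exact: mG.
  - by move=> t _; rewrite patchE; case: ifP => //= _; rewrite lee_fin mulr_ge0.
by move: le; rewrite !intE// -EFinD lee_fin [leRHS]addrAC lerD2r.
Qed.

End slices.

(** Integrals of coordinates of the minimal section are compared chord by chord,
    where the sizes of the bodies cancel; so [C] is chosen before the bodies. *)
Lemma steiner_lipschitz m : exists2 C : R, 0 < C &
  forall (K D : set 'rV[R]_m) (e : R), convex_body K -> convex_body D -> 0 <= e ->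
    excess_le K D e -> excess_le D K e -> enorm (steiner K - steiner D) <= C * e.
Proof.
pose V := fine (lebT (@unit_ball_tuple R m)).
have V0 : 0 < V by exact: ball_volume_gt0.
exists (m%:R * (V^-1 * 2 ^+ m) + 1) => [|K D e cK cD e0 KD DK].
  by rewrite ltr_wpDl// !mulr_ge0 ?invr_ge0 ?(ltW V0)// exprn_ge0.
rewrite mulrDl mul1r -[leLHS]addr0 lerD//.
rewrite (le_trans (enorm_le_sum_coord _))//.
rewrite (le_trans (y := \sum_(i < m) V^-1 * 2 ^+ m * e))//; last first.
  by rewrite sumr_const card_ord -[leLHS]mulr_natl !mulrA.
apply: ler_sum => i _; rewrite !mxE -/(min_section _ _) -!/(min_coord _ _ _).
case: m @V V0 i K D cK cD KD DK => [|k] V V0; first by case.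
move=> i K D cK cD KD DK.
rewrite [X in `|X|](_ : _ = V^-1 *
  (\int[lebT]_(u in unit_ball_tuple) min_coord K i u -
   \int[lebT]_(u in unit_ball_tuple) min_coord D i u)); last by rewrite mulrBr.
rewrite normrM gtr0_norm ?invr_gt0// -mulrA ler_wpM2l ?invr_ge0 ?(ltW V0)//.
have := min_coord_integral_le i cK cD e0 KD DK.
have := min_coord_integral_le i cD cK e0 DK KD.
rewrite ler_norml; move: (Rintegral _ _ _) (Rintegral _ _ _) => a b h1 h2.
by apply/andP; split; lra.
Qed.

End steiner_point.

(** * Epigraphs of conjugate functions *)

Section epigraph.
Context {R : realType} {n : nat}.
Implicit Types (v p q u : 'rV[R]_n) (z y w : 'rV[R]_(n + 1)) (h : 'rV[R]_n -> R).

Local Notation fst_row := (@lsubmx R 1 n 1).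
Definition last_coord z : R := rsubmx z 0 0.
Definition pair_row v (c : R) : 'rV[R]_(n + 1) := row_mx v (const_mx c).

Lemma fst_pair v c : fst_row (pair_row v c) = v.
Proof. exact: row_mxKl. Qed.

Lemma last_pair v c : last_coord (pair_row v c) = c.
Proof. by rewrite /last_coord row_mxKr mxE. Qed.

Lemma fst_rowD z w : fst_row (z + w) = fst_row z + fst_row w.
Proof. by apply/rowP => i; rewrite !mxE. Qed.

Lemma last_coordD z w : last_coord (z + w) = last_coord z + last_coord w.
Proof. by rewrite /last_coord !mxE. Qed.

Lemma fst_rowB z w : fst_row (z - w) = fst_row z - fst_row w.
Proof. by apply/rowP => i; rewrite !mxE. Qed.

Lemma last_coordB z w : last_coord (z - w) = last_coord z - last_coord w.
Proof. by rewrite /last_coord !mxE. Qed.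

Lemma dot_split z w :
  dot z w = dot (fst_row z) (fst_row w) + last_coord z * last_coord w.
Proof.
rewrite /dot big_split_ord /=; congr (_ + _).
  by apply: eq_bigr => i _; rewrite !mxE.
by rewrite big_ord1 /last_coord !mxE.
Qed.

Lemma enorm_fst_le z : enorm (fst_row z) <= enorm z.
Proof.
by apply: enorm_le; rewrite ?enorm_ge0// sqr_enorm dot_split lerDl sqr_ge0.
Qed.

Lemma last_coord_le_enorm z : `|last_coord z| <= enorm z.
Proof. by rewrite /last_coord mxE coord_le_enorm. Qed.

(** The supremum defining the conjugate is unfolded into inequalities, so that
    no extended real occurs. *)
Definition conj_epi h : set 'rV[R]_(n + 1) :=
  [set z | forall p, dot (fst_row z) p - h p <= last_coord z].

Lemma lagrangian_epiE (H : R -> 'rV[R]_n -> 'rV[R]_n -> R) t x :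
  lagrangian_epi H t x = conj_epi (H t x).
Proof.
apply/seteqP; split=> z; rewrite /lagrangian_epi /lagrangian /conj_epi /=.
  by move=> + p => /(le_trans (ereal_sup_ubound _)) => /(_ (dot (fst_row z) p - H t x p)%:E);
    rewrite lee_fin; apply; exists p.
by move=> h; apply: ge_ereal_sup => _ [p _ <-]; rewrite lee_fin h.
Qed.

Lemma conj_epiE h z :
  conj_epi h z <-> forall p, dot (pair_row p (-1)) z <= h p.
Proof.
split=> hz p; have := hz p;
  by rewrite dot_split fst_pair last_pair (dotC p); lra.
Qed.

Lemma conj_epi_closed h : closed (conj_epi h).
Proof.
rewrite (_ : conj_epi h = \bigcap_p [set z | dot (pair_row p (-1)) z <= h p]).
  apply: closed_bigI => p _; apply: closed_sublevel; exact: dot_continuous.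
apply/seteqP; split=> z.
  by move=> /conj_epiE hz p _; exact: hz.
by move=> hz; apply/conj_epiE => p; exact: hz.
Qed.

Lemma conj_epi_convex h : convex_set (conj_epi h).
Proof.
apply/convex_setP => y z l l0 l1 /conj_epiE hy /conj_epiE hz; apply/conj_epiE => p.
rewrite dotDr dotZr dotDr dotNr; have := hy p; have := hz p.
set a := dot _ z; set b := dot _ y => h1 h2.
by have := ler_wpM2l l0 h1; have : 0 <= 1 - l by [lra]; move/ler_wpM2l => /(_ _ _ h2); lra.
Qed.

Lemma conj_epi_up h z (c : R) : conj_epi h z -> 0 <= c ->
  conj_epi h (z + pair_row 0 c).
Proof.
move=> /conj_epiE hz c0; apply/conj_epiE => p.
have := hz p; rewrite dotDr [dot _ (pair_row 0 c)]dot_split !fst_pair !last_pair dot0r; lra.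
Qed.

Section convex_conjugate.
Variable h : 'rV[R]_n -> R.
Hypotheses (cvxh : convex_function setT h) (ch : continuous h).

Let epi : set 'rV[R]_(n + 1) := [set z | h (fst_row z) <= last_coord z].

Let epi_nonempty : epi !=set0.
Proof. by exists (pair_row 0 (h 0)); rewrite /epi /= fst_pair last_pair. Qed.

Let epi_closed : closed epi.
Proof.
rewrite (_ : epi = [set z | h (fst_row z) - last_coord z <= 0]); last first.
  by apply/seteqP; split=> z; rewrite /epi /= subr_le0.
apply: closed_sublevel => z; apply: continuousB.
  apply: continuous_comp; last exact: ch.
  exact: continuous_lsubmx.
apply: (@continuous_comp _ _ _ (@rsubmx R 1 n 1) (fun w : 'M[R]_(1, 1) => w 0 0)); last exact: coord_continuous.
exact: continuous_rsubmx.
Qed.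

Let epi_convex : convex_set epi.
Proof.
apply/convex_setP => y z l l0 l1; rewrite /epi /= => hy hz.
have l01 : Itv.spec (@Itv.num_sem _) (Itv.Real `[0%Z, 1%Z]) l.
  by rewrite /Itv.spec/= /Itv.num_sem num_real/= in_itv/= l0.
have := cvxh (Itv.mk l01) (x := fst_row z) (y := fst_row y).
rewrite !inE => /(_ I I) /= hl.
have -> : fst_row (y + l *: (z - y)) =
    convex.conv (Itv.mk l01) (fst_row z : convex_lmodType _) (fst_row y).
  rewrite /convex.conv /= /unstable.onem.
  by apply/rowP => i; rewrite !mxE; ring.
rewrite (le_trans hl)// convRE /= /unstable.onem.
have -> : last_coord (y + l *: (z - y)) = l * last_coord z + (1 - l) * last_coord y.
  by rewrite /last_coord !mxE; ring.
by rewrite lerD// ler_wpM2l// subr_ge0.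
Qed.

(** Separating a point slightly below the graph from the epigraph gives an
    affine minorant; the separating normal is not horizontal because [h] is
    finite everywhere. *)
Lemma approx_subgradient p (d : R) : 0 < d ->
  exists u, forall q, h p - d + dot u (q - p) <= h q.
Proof.
move=> d0; set a := pair_row p (h p - d).
have zE := proj_in epi_nonempty epi_closed epi_convex a.
have obt := proj_obtuse epi_nonempty epi_closed epi_convex a.
set z := eproj epi a in zE obt.
set w1 := p - fst_row z; set w2 := h p - d - last_coord z.
have obt' q c : h q <= c -> dot w1 (q - fst_row z) + w2 * (c - last_coord z) <= 0.
  move=> hq; have := obt (pair_row q c).
  rewrite dot_split !fst_rowB !last_coordB !fst_pair !last_pair; apply.
  by rewrite /epi /= fst_pair last_pair.
have w20 : w2 <= 0.
  have := obt' (fst_row z) (last_coord z + 1).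
  rewrite subrr dot0r addrAC subrr !add0r mulr1; apply.
  by rewrite (le_trans zE)// lerDl.
have {w20} w20 : w2 < 0.
  rewrite lt_neqAle w20 andbT; apply/eqP => w2E.
  have := obt' p _ (lexx _); rewrite -/w1 w2E mul0r addr0 => w1w1.
  have w1E : w1 = 0.
    by apply/enorm_eq0/eqP; rewrite -sqrf_eq0 sqr_enorm eq_le w1w1 dot_ge0.
  move: zE; rewrite /epi /=; have /eqP := w1E; rewrite subr_eq0 => /eqP <-.
  by move: w2E; rewrite /w2; lra.
exists ((- w2)^-1 *: w1) => q.
have := obt' q _ (lexx _).
have -> : q - fst_row z = (q - p) + w1 by rewrite /w1 addrA subrK.
have -> : h q - last_coord z = (h q - h p + d) + w2 by rewrite /w2; ring.
rewrite dotDr dotZl; have := dot_ge0 w1; have := sqr_ge0 w2.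
set A := dot w1 (q - p) => h1 h2 h3.
have nw : 0 < - w2 by rewrite oppr_gt0.
have : (- w2)^-1 * A <= h q - h p + d; last by lra.
by rewrite mulrC ler_pdivrMr//; rewrite expr2 in h1; lra.
Qed.

(** Half of biconjugation; an error [d] is allowed, which spares a proof that
    the supremum is attained. *)
Lemma conj_epi_sup p (d : R) : 0 < d ->
  exists2 z, conj_epi h z & h p - d <= dot (fst_row z) p - last_coord z.
Proof.
move=> d0; have [u uP] := approx_subgradient p d0.
exists (pair_row u (dot u p - h p + d)); rewrite ?fst_pair ?last_pair; last by lra.
by move=> q; rewrite fst_pair last_pair; have := uP q; rewrite dotDr dotNr; lra.
Qed.

Lemma conj_epi_nonempty : conj_epi h !=set0.
Proof. by have [z zE _] := conj_epi_sup 0 ltr01; exists z. Qed.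

End convex_conjugate.

(** If [h1 <= h2 + e (1 + |.|)], lift a point of the first epigraph by [e] and
    project it onto the second.  The normal [q] at the projection is, up to
    scaling, a momentum at which the hypothesis bounds [|q|^2] by [e |q|]; a
    horizontal normal is dealt with by letting the momentum tend to infinity. *)
Lemma conj_epi_excess h1 h2 (e : R) :
  convex_function setT h2 -> continuous h2 -> 0 <= e ->
  (forall p, h1 p <= h2 p + e * (1 + enorm p)) ->
  excess_le (conj_epi h1) (conj_epi h2) (2 * e).
Proof.
move=> cvx2 c2 e0 h12 z z1.
have E0 := conj_epi_nonempty cvx2 c2.
have clE := @conj_epi_closed h2; have cvxE := @conj_epi_convex h2.
set a := z + pair_row 0 e.
have yE := proj_in E0 clE cvxE a; have obt := proj_obtuse E0 clE cvxE a.
set y := eproj _ a in yE obt; set q := a - y in obt.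
exists y => //.
suff qe : enorm q <= e.
  rewrite (le_trans (enorm_triangle a _ _))// [leRHS]mulr_natl mulr2n lerD//.
  rewrite enormB /a addrAC subrr add0r; apply: enorm_le => //.
  by rewrite dot_split fst_pair last_pair dot0l add0r expr2.
set q1 := fst_row q; set q2 := last_coord q.
have q20 : q2 <= 0.
  have := obt _ (conj_epi_up yE ler01); rewrite addrAC subrr add0r dot_split.
  by rewrite fst_pair last_pair dot0r add0r mulr1.
have aP p : dot (fst_row a) p - h2 p - e * enorm p <= last_coord a.
  have := z1 p; have := h12 p.
  rewrite /a fst_rowD last_coordD fst_pair last_pair addr0.
  lra.
have qq : dot q q = dot q a - dot q y by rewrite -dotNr -dotDr.
suff : dot q q <= e * enorm q.
  rewrite dotxx; have [->//|qn] := eqVneq (enorm q) 0.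
  by rewrite ler_pM2r// lt_neqAle eq_sym qn enorm_ge0.
apply: (@le_trans _ _ (e * enorm q1)); last by rewrite ler_wpM2l// enorm_fst_le.
have [q2E|q2n] := eqVneq q2 0; last first.
  have c0 : 0 < - q2 by rewrite oppr_gt0 lt_neqAle q2n.
  pose p := (- q2)^-1 *: q1.
  have pc : - q2 *: p = q1 by rewrite scalerA divff ?scale1r// gt_eqF.
  have dq x : dot q x = - q2 * (dot (fst_row x) p - last_coord x).
    by rewrite dot_split -/q1 -/q2 -pc dotZl (dotC p); ring.
  have h2y : h2 p <= dot (fst_row y) p - last_coord y.
    apply/ler_addgt0Pr => d d0.
    have [x xE hx] := conj_epi_sup cvx2 c2 p d0.
    have := obt x xE; rewrite dotDr dotNr !dq -mulrBr pmulr_rle0//; lra.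
  have en : e * enorm q1 = - q2 * (e * enorm p).
    by rewrite -pc enormZ gtr0_norm//; ring.
  rewrite qq !dq en -mulrBr ler_pM2l//; have := aP p; lra.
have dq x : dot q x = dot (fst_row x) q1.
  by rewrite dot_split -/q1 -/q2 q2E mul0r addr0 dotC.
pose k := last_coord a + h2 0.
have ks s : 0 < s -> s * (dot q q - e * enorm q1) <= k.
  move=> s0; rewrite qq !dq; apply/ler_addgt0Pr => d d0.
  have [x xE hx] := conj_epi_sup cvx2 c2 (s *: q1) d0.
  have := aP (s *: q1); rewrite enormZ gtr0_norm// dotZr.
  have := xE 0; rewrite dot0r sub0r.
  have := obt x xE; rewrite dotDr dotNr subr_le0 !dq => /(ler_wpM2l (ltW s0)).
  by move: hx; rewrite dotZr /k; lra.
(* let [s] tend to infinity in [ks] *)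
rewrite -subr_le0 leNgt; apply/negP => g0; set g := _ - _ in g0 ks.
have k0 : 0 <= k by rewrite (le_trans _ (ks 1 ltr01))// mul1r ltW.
have s0 : 0 < (k + 1) / g by rewrite divr_gt0// ltr_wpDl.
by have := ks _ s0; rewrite divfK ?gt_eqF//; lra.
Qed.

(** Testing the inequalities at large multiples of the first component [v]
    itself: their left-hand sides grow linearly as soon as [|v|] exceeds [c]. *)
Lemma conj_epi_lipschitz h (c : R) z : 0 <= c ->
  (forall p q, `|h p - h q| <= c * enorm (p - q)) ->
  conj_epi h z -> enorm (fst_row z) <= c.
Proof.
move=> c0 hc zE; set v := fst_row z; rewrite leNgt; apply/negP => cv.
have v0 : 0 < enorm v by exact: le_lt_trans cv.
pose g := enorm v * (enorm v - c).
have g0 : 0 < g by rewrite mulr_gt0// subr_gt0.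
pose k := last_coord z + h 0.
have ks s : 0 < s -> s * g <= k.
  move=> s0; have : dot v (s *: v) - h (s *: v) <= last_coord z by exact: zE.
  have := hc (s *: v) 0.
  rewrite subr0 enormZ (gtr0_norm s0) dotZr dotxx ler_norml => /andP[_].
  by rewrite /g /k; lra.
have k0 : 0 <= k by rewrite (le_trans _ (ks 1 ltr01))// mul1r ltW.
have s0 : 0 < (k + 1) / g by rewrite divr_gt0// ltr_wpDl.
by have := ks _ s0; rewrite divfK ?gt_eqF//; lra.
Qed.

End epigraph.

(** * Truncation by balls *)

Section truncation.
Context {R : realType} {m : nat}.
Implicit Types (E D : set 'rV[R]_m) (a : 'rV[R]_m).

Definition truncation E a := E `&` eball a (2 * Defs.edist a E).

Lemma truncation_convex_body E a :
  E !=set0 -> closed E -> convex_set E -> convex_body (truncation E a).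
Proof.
move=> E0 clE cvxE; split.
- exists (eproj E a); split; first exact: proj_in.
  rewrite /eball /= edistE// (enormB a); have := enorm_ge0 (eproj E a - a); lra.
- apply: (@bounded_enorm_compact _ _ _ (2 * Defs.edist a E + enorm a)).
    by apply: closedI => //; exact: closed_eball.
  by move=> x [_ xa]; rewrite -[x](subrK a) (le_trans (enormD _ _))// lerD2r.
- apply/convex_setP => x y l l0 l1 [Ex xa] [Ey ya].
  split; first by move/convex_setP : cvxE; exact.
  rewrite /eball /=.
  rewrite (_ : x + l *: (y - x) - a = (1 - l) *: (x - a) + l *: (y - a)); last first.
    by apply/rowP => i; rewrite !mxE; ring.
  rewrite (le_trans (enormD _ _))// !enormZ !ger0_norm ?subr_ge0//.
  have l1' : 0 <= 1 - l by rewrite subr_ge0.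
  by have := ler_wpM2l l1' xa; have := ler_wpM2l l0 ya; lra.
Qed.

(** A point of [D] near the truncation of [E] may miss the truncation of [D],
    but its distance to [a] exceeds the allowed radius by [3 e] at most;
    moving it towards the nearest point of [D], whose distance to [a] is only
    half that radius, brings it back at a cost proportional to [e]. *)
Lemma truncation_excess E D a (e : R) : 0 < e ->
  E !=set0 -> closed E -> convex_set E -> D !=set0 -> closed D -> convex_set D ->
  excess_le E D e -> excess_le D E e ->
  excess_le (truncation E a) (truncation D a) (10 * e).
Proof.
move=> e0 E0 clE cvxE D0 clD cvxD ED DE z [Ez].
rewrite /eball /= edistE// => za.
have [z' Dz' zz'] := ED z Ez.
set y := eproj D a; set d := enorm (a - y).
have d0 : 0 <= d by exact: enorm_ge0.
have Dy : D y by exact: proj_in.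
have dE : enorm (a - eproj E a) <= d + e.
  have [x Ex yx] := DE y Dy.
  rewrite (le_trans (proj_nearest E0 clE cvxE a Ex))//.
  by rewrite (le_trans (enorm_triangle y _ _))// lerD2l.
have z'a : enorm (z' - a) <= 2 * d + 3 * e.
  have := enorm_triangle z z' a; rewrite (enormB z' z); lra.
have ya : enorm (y - a) = d by rewrite enormB.
have de : 0 < d + 3 * e by lra.
(* the fraction of the way that brings a point at distance 2 d + 3 e from [a]
   back to distance 2 d, moving towards a point at distance d *)
pose l := 3 * e / (d + 3 * e).
have lE : l * (d + 3 * e) = 3 * e by rewrite divfK// gt_eqF.
have l0 : 0 <= l by rewrite divr_ge0 ?ltW// mulr_gt0.
have l1 : l <= 1 by rewrite ler_pdivrMr// mul1r lerDr.
have l1' : 0 <= 1 - l by rewrite subr_ge0.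
exists (z' + l *: (y - z')).
  split; first by move/convex_setP : cvxD; exact.
  rewrite /eball /= edistE// -/y -/d.
  rewrite (_ : z' + l *: (y - z') - a = (1 - l) *: (z' - a) + l *: (y - a)); last first.
    by apply/rowP => i; rewrite !mxE; ring.
  rewrite (le_trans (enormD _ _))// !enormZ !ger0_norm// ya.
  by have := ler_wpM2l l1' z'a; lra.
rewrite (le_trans (enorm_triangle z' _ _))//.
rewrite opprD addrA subrr add0r enormN enormZ ger0_norm//.
have yz' : enorm (y - z') <= 3 * d + 3 * e.
  have := enorm_triangle a y z'; rewrite (enormB a z'); lra.
have := ler_wpM2l l0 yz'; have := mulr_ge0 l0 (ltW e0); lra.
Qed.

End truncation.

(** * Stability of the canonical representation *)

Section stability.
Context {R : realType}.

Lemma cvg_ge0_to0P (u : nat -> \bar R) : (forall i, 0 <= u i)%E ->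
  u i @[i --> \oo] --> 0%E <->
  forall e : R, 0 < e -> \forall i \near \oo, (u i <= e%:E)%E.
Proof.
move=> u0; split=> [/fine_cvgP[uf uc] e e0|h].
  have /cvgrPdist_le/(_ _ e0) := uc; apply: filterS2 uf => i ui.
  by rewrite sub0r normrN /= -[u i in X in _ -> X](fineK ui) lee_fin; apply: le_trans; exact: ler_norm.
apply/fine_cvgP; split.
  apply: filterS (h 1 ltr01) => i ui.
  by rewrite ge0_fin_numE// (le_lt_trans ui)// ltry.
apply/cvgrPdist_le => e e0; apply: filterS (h e e0) => i ui.
have uf : u i \is a fin_num by rewrite ge0_fin_numE// (le_lt_trans ui)// ltry.
by rewrite sub0r normrN /= ger0_norm ?fine_ge0// -lee_fin fineK.
Qed.

Context {n : nat} (T : R).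
Implicit Types (H : R -> 'rV[R]_n -> 'rV[R]_n -> R).

Lemma admissible_convex_continuous H t x : admissible T H -> t \in `[0, T] ->
  convex_function setT (H t x) /\ continuous (H t x).
Proof.
move=> [_ cH cvxH _] tT; split; first exact: cvxH.
move=> p; apply: (@continuous_comp _ _ _ (fun p : 'rV[R]_n => (x, p))
  (fun z : 'rV[R]_n * 'rV[R]_n => H t z.1 z.2)); last exact: cH.
have := @cvg_pair _ _ _ (nbhs p) (nbhs x) (nbhs p) (nbhs_filter p)
  (nbhs_filter x) (nbhs_filter p) (fun=> x) id.
apply; last exact: cvg_id.
exact: (@cst_continuous _ _ x).
Qed.

Lemma canon_eE H t x a : canon_e H t x a = steiner (truncation (conj_epi (H t x)) a).
Proof. by rewrite /canon_e lagrangian_epiE. Qed.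

Lemma epi_truncation_convex_body (h : 'rV[R]_n -> R) a :
  convex_function setT h -> continuous h -> convex_body (truncation (conj_epi h) a).
Proof.
move=> cvxh ch; apply: truncation_convex_body.
- exact: conj_epi_nonempty.
- exact: conj_epi_closed.
- exact: conj_epi_convex.
Qed.

(** The composite of three Lipschitz steps: Hamiltonian to epigraph, epigraph
    to truncation, truncation to Steiner point. *)
Lemma canon_e_stable : exists2 C : R, 0 < C &
  forall H H' t x a (e : R),
    convex_function setT (H t x) -> continuous (H t x) ->
    convex_function setT (H' t x) -> continuous (H' t x) -> 0 < e ->
    (forall p, `|H t x p - H' t x p| <= e * (1 + enorm p)) ->
    enorm (canon_e H t x a - canon_e H' t x a) <= C * e.
Proof.
have [C C0 hC] := @steiner_lipschitz R (n + 1).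
exists (20 * C) => [|H H' t x a e cvx c cvx' c' e0 HH']; first by rewrite mulr_gt0.
have e20 : 0 < 2 * e by rewrite mulr_gt0.
have le : excess_le (conj_epi (H t x)) (conj_epi (H' t x)) (2 * e).
  apply: conj_epi_excess => //; first exact: ltW.
  by move=> p; have := HH' p; rewrite ler_norml => /andP[]; lra.
have le' : excess_le (conj_epi (H' t x)) (conj_epi (H t x)) (2 * e).
  apply: conj_epi_excess => //; first exact: ltW.
  by move=> p; have := HH' p; rewrite ler_norml => /andP[]; lra.
have E0 := conj_epi_nonempty cvx c; have E0' := conj_epi_nonempty cvx' c'.
have clE := @conj_epi_closed R n; have cvxE := @conj_epi_convex R n.
rewrite !canon_eE (_ : 20 * C * e = C * (10 * (2 * e))); last by ring.
apply: hC; try exact: epi_truncation_convex_body.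
- by rewrite mulr_ge0// ltW.
- exact: truncation_excess.
- exact: truncation_excess.
Qed.

Lemma canon_f_le H t x a (c : R) :
  convex_function setT (H t x) -> continuous (H t x) -> 0 <= c ->
  (forall p q, `|H t x p - H t x q| <= c * enorm (p - q)) ->
  enorm (canon_f H t x a) <= c.
Proof.
move=> cvx ch c0 hc; apply: (conj_epi_lipschitz c0 hc).
have [] := steiner_in (epi_truncation_convex_body a cvx ch).
by rewrite -canon_eE.
Qed.

End stability.

Theorem theorem3p14 (R : realType) (n : nat) (T : R)
    (Hs : nat -> R -> 'rV[R]_n -> 'rV[R]_n -> R)
    (H : R -> 'rV[R]_n -> 'rV[R]_n -> R)
    (admHs : forall i, admissible T (Hs i)) (admH : admissible T H) :
  ((forall t r, t \in `[0, T] -> 0 < r ->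
      ereal_sup [set (`|Hs i t x p - H t x p| / (1 + enorm p))%:E
                | x in eball 0 r & p in setT] @[i --> \oo] --> 0%E) ->
    forall t r, t \in `[0, T] -> 0 < r ->
      (ereal_sup [set (enorm (canon_f (Hs i) t x a - canon_f H t x a))%:E
                 | x in eball 0 r & a in setT] @[i --> \oo] --> 0%E) /\
      (ereal_sup [set (`|canon_l (Hs i) t x a - canon_l H t x a|)%:E
                 | x in eball 0 r & a in setT] @[i --> \oo] --> 0%E)) /\
  (forall (cs : nat -> R -> R) (c : R -> R),
    (forall i, lebesgue_measurable_fun `[0, T] (cs i)) ->
    lebesgue_measurable_fun `[0, T] c ->
    (forall i t, t \in `[0, T] -> 0 <= cs i t) ->
    (forall t, t \in `[0, T] -> 0 <= c t) ->
    (forall i t x p q, t \in `[0, T] ->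
      `|Hs i t x p - Hs i t x q| <= cs i t * (1 + enorm x) * enorm (p - q)) ->
    (forall t x p q, t \in `[0, T] ->
      `|H t x p - H t x q| <= c t * (1 + enorm x) * enorm (p - q)) ->
    (forall i t x a, t \in `[0, T] ->
      enorm (canon_f (Hs i) t x a) <= cs i t * (1 + enorm x)) /\
    (forall t x a, t \in `[0, T] ->
      enorm (canon_f H t x a) <= c t * (1 + enorm x))).
Proof.
split=> [Hcvg t r tT r0|cs c _ _ cs0 c0 csP cP]; last first.
  have adm (G : R -> 'rV[R]_n -> 'rV[R]_n -> R) (g : R -> R) : admissible T G ->
      (forall t, t \in `[0, T] -> 0 <= g t) ->
      (forall t x p q, t \in `[0, T] ->
        `|G t x p - G t x q| <= g t * (1 + enorm x) * enorm (p - q)) ->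
      forall t x a, t \in `[0, T] -> enorm (canon_f G t x a) <= g t * (1 + enorm x).
    move=> admG g0 gP t x a tT.
    have [cvx cont] := admissible_convex_continuous x admG tT.
    apply: canon_f_le => //; first by rewrite mulr_ge0 ?g0// addr_ge0// enorm_ge0.
    by move=> p q; exact: gP.
  split=> [i t x a tT|t x a tT]; apply: adm => //; [exact: cs0|].
  by move=> *; exact: csP.
have [C C0 hC] := @canon_e_stable R n.
have B0 : eball (0 : 'rV[R]_n) r 0 by rewrite /eball /= subr0 enorm0 ltW.
have H0 : forall e : R, 0 < e -> \forall i \near \oo, forall x p, eball 0 r x ->
    `|Hs i t x p - H t x p| <= e * (1 + enorm p).
  move=> e e0; have := Hcvg t r tT r0; rewrite cvg_ge0_to0P; last first.
    move=> i; apply: (@le_trans _ _ (`|Hs i t 0 0 - H t 0 0| / (1 + enorm (0 : 'rV[R]_n)))%:E).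
      by rewrite lee_fin divr_ge0// addr_ge0// enorm_ge0.
    by apply: ereal_sup_ubound; exists 0 => //; exists 0.
  move=> /(_ e e0); apply: filterS => i hi x p xr.
  rewrite -ler_pdivrMr ?ltr_wpDr ?enorm_ge0// -lee_fin.
  by apply: le_trans hi; apply: ereal_sup_ubound; exists x => //; exists p.
have e_small (e : R) : 0 < e -> \forall i \near \oo, forall x a, eball 0 r x ->
    enorm (canon_e (Hs i) t x a - canon_e H t x a) <= e.
  move=> e0; have eC : 0 < e / C by rewrite divr_gt0.
  apply: filterS (H0 _ eC) => i hi x a xr.
  rewrite -[leRHS](divfK (x := C)) ?gt_eqF// mulrC.
  have [cvx cont] := admissible_convex_continuous x (admHs i) tT.
  have [cvx' cont'] := admissible_convex_continuous x admH tT.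
  by apply: hC => // p; exact: hi.
split; apply/cvg_ge0_to0P.
- move=> i; apply: (@le_trans _ _ (enorm (canon_f (Hs i) t 0 0 - canon_f H t 0 0))%:E).
    by rewrite lee_fin enorm_ge0.
  by apply: ereal_sup_ubound; exists 0 => //; exists 0.
- move=> e e0; apply: filterS (e_small e e0) => i hi.
  apply: ge_ereal_sup => _ [x xr [a _ <-]]; rewrite lee_fin (le_trans _ (hi x a xr))//.
  by rewrite /canon_f -fst_rowB enorm_fst_le.
- move=> i; apply: (@le_trans _ _ (`|canon_l (Hs i) t 0 0 - canon_l H t 0 0|)%:E).
    by rewrite lee_fin.
  by apply: ereal_sup_ubound; exists 0 => //; exists 0.
- move=> e e0; apply: filterS (e_small e e0) => i hi.
  apply: ge_ereal_sup => _ [x xr [a _ <-]]; rewrite lee_fin (le_trans _ (hi x a xr))//.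
  by rewrite -[canon_l _ _ _ _ - _]last_coordB last_coord_le_enorm.
Qed.
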